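(* Let $m,n$ be positive integers with $m<n$ and $m$ even, and let $G$ be a finite simple graph with maximum degree $\Delta(G)=3$. Then $\chi(G^{\frac{m}{n}})=\omega(G^{\frac{m}{n}})$.
   Context: For a graph $G$ and positive integer $n$, the $n$-subdivision $G^{\frac{1}{n}}$ is obtained from $G$ by replacing each edge with a path of length $n$. For a graph $H$ and positive integer $m$, the $m$-th power $H^m$ is the graph on $V(H)$ in which two distinct vertices are adjacent iff their distance in $H$ is at most $m$. The fractional power is $G^{\frac{m}{n}}=(G^{\frac{1}{n}})^m$. $\chi$ denotes the chromatic number and $\omega$ the clique number. *)

(* Defs.v *)
From mathcomp Require Import all_boot.

Set Implicit Arguments.
Unset Strict Implicit.
Unset Printing Implicit Defensive.

Record sgraph := SGraph {
  svertex :> finType;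
  adj : rel svertex;
  adj_sym : symmetric adj;
  adj_irrefl : irreflexive adj }.

Definition max_degree (G : sgraph) : nat :=
  \max_(v : G) #|[set w : G | adj v w]|.

Definition proper_coloring (G : sgraph) (k : nat) (f : {ffun G -> 'I_k}) : bool :=
  [forall u, forall v, adj u v ==> (f u != f v)].

Definition colorable (G : sgraph) (k : nat) : bool :=
  [exists f : {ffun G -> 'I_k}, proper_coloring f].

Lemma colorable_ex (G : sgraph) : exists k, colorable G k.
Proof.
exists #|G|; apply/existsP; exists [ffun v => enum_rank v].
apply/forallP=> u; apply/forallP=> v; apply/implyP=> uv; rewrite !ffunE.
by apply: contraTneq uv => /enum_rank_inj ->; rewrite adj_irrefl.
Qed.

Definition chromatic_number (G : sgraph) : nat := ex_minn (colorable_ex G).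

Definition clique (G : sgraph) (A : {set G}) : bool :=
  [forall u in A, forall v in A, (u != v) ==> adj u v].

Definition clique_number (G : sgraph) : nat :=
  \max_(A : {set G} | clique A) #|A|.

Definition walk (G : sgraph) (u v : G) (k : nat) : bool :=
  [exists p : k.-tuple G, path (@adj G) u p && (last u p == v)].

(* A shortest path has length < #|G|, so this is the graph distance when u and
   v are connected; otherwise it takes the junk value #|G|, and the distance
   is to be read as infinite. *)
Definition dist (G : sgraph) (u v : G) : nat := find (walk u v) (iota 0 #|G|).

Definition power_adj (H : sgraph) (m : nat) : rel H :=
  fun u v => [&& u != v, connect (@adj H) u v & dist u v <= m].

Lemma walk_sym (G : sgraph) (u v : G) k : walk u v k = walk v u k.
Proof.
have imp (x y : G) : walk x y k -> walk y x k.
  case/existsP=> p /andP[xp /eqP <-].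
  have sz : size (rev (belast x p)) == k by rewrite size_rev size_belast size_tuple.
  apply/existsP; exists (Tuple sz) => /=; apply/andP; split.
    rewrite rev_path; apply: sub_path xp => a b /=; by rewrite adj_sym.
  by case: (tval p) => //= z s; rewrite rev_cons last_rcons.
by apply/idP/idP; apply: imp.
Qed.

Lemma power_adj_sym (H : sgraph) m : symmetric (@power_adj H m).
Proof.
move=> u v; rewrite /power_adj eq_sym (sym_connect_sym (@adj_sym H)) /dist.
by rewrite (eq_find (walk_sym u v)).
Qed.

Lemma power_adj_irrefl (H : sgraph) m : irreflexive (@power_adj H m).
Proof. by move=> u; rewrite /power_adj eqxx. Qed.

Definition power (H : sgraph) (m : nat) : sgraph :=
  SGraph (@power_adj_sym H m) (@power_adj_irrefl H m).

(* Each edge is represented once, oriented along the enumeration of G; the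
   orientation only serves to number the inner vertices of the path that
   replaces the edge. *)
Definition edge (G : sgraph) : finType :=
  {p : G * G | adj p.1 p.2 && (enum_rank p.1 < enum_rank p.2)}.

Definition subdiv_vertex (G : sgraph) (n : nat) : finType :=
  (G + edge G * 'I_n.-1)%type.

(* The i-th vertex, 0 <= i <= n, of the path of length n replacing the edge a:
   its ends are those of a, and for 0 < i < n it is the inner vertex (a, i.-1).
   The last case is reached exactly when 0 < i and n <= i. *)
Definition subdiv_pt (G : sgraph) (n : nat) (a : edge G) (i : nat) :
    subdiv_vertex G n :=
  if i == 0 then inl (val a).1
  else if insub i.-1 is Some j then inr (a, j)
  else inl (val a).2.

Definition subdiv_adj (G : sgraph) (n : nat) : rel (subdiv_vertex G n) :=
  fun u v => [exists a : edge G, exists i : 'I_n,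
    ((u == subdiv_pt n a i) && (v == subdiv_pt n a i.+1)) ||
    ((v == subdiv_pt n a i) && (u == subdiv_pt n a i.+1))].

Lemma subdiv_adj_sym (G : sgraph) n : symmetric (@subdiv_adj G n).
Proof.
by move=> u v; apply: eq_existsb => a; apply: eq_existsb => i; rewrite orbC.
Qed.

Lemma subdiv_pt_neq (G : sgraph) n (a : edge G) i :
  i < n -> subdiv_pt n a i != subdiv_pt n a i.+1.
Proof.
rewrite /subdiv_pt /=; case: i => [|i] i_n /=.
  case: insubP => //= _; case: a => [[x y] /= /andP[xy _]].
  by apply: contraTneq xy => -[->]; rewrite adj_irrefl.
case: insubP => [j _ ji|]; last by case: n i_n => //= n; rewrite ltnS => ->.
case: insubP => //= k _ ki; apply/eqP=> -[jk].
by move: ki; rewrite -jk ji => /n_Sn.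
Qed.

Lemma subdiv_adj_irrefl (G : sgraph) n : irreflexive (@subdiv_adj G n).
Proof.
move=> u; apply/existsP=> -[a /existsP[i]]; rewrite orbb => /andP[/eqP-> ].
by rewrite (negbTE (subdiv_pt_neq a (ltn_ord i))).
Qed.

Definition subdivision (G : sgraph) (n : nat) : sgraph :=
  SGraph (@subdiv_adj_sym G n) (@subdiv_adj_irrefl G n).

Definition fractional_power (G : sgraph) (m n : nat) : sgraph :=
  power (subdivision G n) m.

(* Main.v *)
Require Import Defs.
From mathcomp Require Import all_boot.
From mathcomp Require Import zify.

Set Implicit Arguments.
Unset Strict Implicit.
Unset Printing Implicit Defensive.

(* Put [m = 2 k].  The ball of radius [k] around a vertex of degree 3 is a clique
   of size [3 k + 1], so it suffices to color with [3 k + 1] colors.  Inserting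
   [2 k + 1] consecutive colors again into the color sequence of each edge is
   harmless, so one may assume [n = 2 k + 1 + d] with [d <= 2 k].

   The colors are one center and three letters with [k] levels each.  Around a
   vertex, the three half-edges get distinct letters, and the levels of a letter
   appear along its half-edge in increasing or decreasing order, as prescribed
   by one bit per vertex and letter; then the [d] inner vertices of each edge
   have to be filled.

   If [d <= k], the two half-edges of an edge get distinct letters, and the inner
   vertices use the third one; this works if its bits at the two ends differ.
   Such labels and bits are found by adding the vertices one at a time.  A
   vertex can be added unless its three neighbors offer the same letter to it,
   and then this obstruction is moved along a cycle until it disappears.

   If [k < d], an edge can be filled if all bits at its two ends differ, or if its
   two half-edges have the same letter and the bits of this letter differ (here
   the center belongs to one of the letters).  Choose disjoint independent sets
   [S0] and [S1] covering as many vertices as possible, with constant bits 0 on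
   [S0] and 1 on [S1].  An uncovered vertex has neighbors in [S0] and in [S1],
   hence at most one uncovered neighbor.  The edges between covered vertices and
   uncovered vertices without uncovered neighbor form a bipartite graph, whose
   edges are 3-colored by Konig's theorem; the pairs of adjacent uncovered
   vertices are then labelled greedily. *)

(** * Powers and subdivisions *)

Lemma power_adj_path (H : sgraph) m (u v : H) p :
  u != v -> path (@adj H) u p -> last u p = v -> size p <= m ->
  @power_adj H m u v.
Proof.
move=> uv pp lp sp; rewrite /power_adj uv /=; apply/andP; split.
  by apply/connectP; exists p.
have w : walk u v (size p).
  by apply/existsP; exists (in_tuple p); rewrite /= pp lp eqxx.
(* For a walk with at least [#|H|] steps the bound is trivial: [dist] never exceeds its junk value
   [#|H|]. *)
apply: leq_trans sp; rewrite /dist; case: (ltnP (size p) #|H|) => szp.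
  rewrite leqNgt; apply/negP => lt; have := before_find 0 lt.
  by rewrite nth_iota // add0n w.
by apply: leq_trans szp; rewrite -{2}(size_iota 0 #|H|) find_size.
Qed.

Lemma power_adj_walk (H : sgraph) m (u v : H) :
  @power_adj H m u v ->
  exists p, [/\ path (@adj H) u p, last u p = v & size p <= m].
Proof.
case/and3P=> _ /connectP[p pp lp] dm.
(* A repetition-free path has fewer than [#|H|] steps, so [find] succeeds and [dist] is not the junk
   value. *)
have hw : has (walk u v) (iota 0 #|H|).
  case/shortenP: pp lp => q qp uq _ lq; apply/hasP; exists (size q).
    by rewrite mem_iota add0n /=; rewrite -[(size q).+1]/(size (u :: q)) -(card_uniqP uq) max_card.
  by apply/existsP; exists (in_tuple q); rewrite /= qp lq eqxx.
have := nth_find 0 hw; rewrite has_find size_iota in hw.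
rewrite nth_iota // add0n -/(dist u v) => /existsP[q /andP[qp /eqP lq]].
by exists q; rewrite size_tuple.
Qed.

Lemma clique_number_leq (G : sgraph) : clique_number G <= chromatic_number G.
Proof.
rewrite /chromatic_number; case: ex_minnP => k /existsP[f /forallP fP] _.
apply/bigmax_leqP => A /forall_inP clA.
have injf : {in A &, injective f}.
  move=> u v uA vA fuv; apply/eqP; apply/negPn/negP => nuv.
  have /forall_inP/(_ v vA)/implyP/(_ nuv) uv := clA u uA.
  by have /forallP/(_ v)/implyP/(_ uv) := fP u; rewrite fuv eqxx.
by rewrite -(card_in_imset injf) -[k in _ <= k]card_ord max_card.
Qed.

(** * Distances in the subdivision, and colorings given edge by edge *)

Section Subdivision.
Variables (G : sgraph) (n : nat).
Hypothesis n_gt0 : 0 < n.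
Implicit Types (v w : G) (i j : nat).

(* The vertex at distance [i] from [v] on the path replacing the edge [vw]. *)
Definition spt v w i : subdiv_vertex G n :=
  if insub (v, w) is Some a then subdiv_pt n a i
  else if insub (w, v) is Some a then subdiv_pt n a (n - i)
  else inl v.

Lemma edgeP v w : adj v w ->
  (exists2 a : edge G, val a = (v, w) & forall i, spt v w i = subdiv_pt n a i)
  \/ (exists2 a : edge G, val a = (w, v) &
       forall i, spt v w i = subdiv_pt n a (n - i)).
Proof.
move=> vw; rewrite /spt; case: insubP => [a _ av|]; first by left; exists a.
rewrite /= vw /= -leqNgt leq_eqVlt => /orP[/eqP/val_inj/enum_rank_inj e|lt].
  by rewrite e adj_irrefl in vw.
case: insubP => [a _ av|]; last by rewrite /= adj_sym vw lt.
by right; exists a.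
Qed.

Lemma edge_adj (a : edge G) : adj (val a).1 (val a).2.
Proof. by have /andP[] := valP a. Qed.

Lemma spt_edge (a : edge G) i : spt (val a).1 (val a).2 i = subdiv_pt n a i.
Proof.
rewrite /spt; case: insubP => [b _ bv|].
  by congr subdiv_pt; apply: val_inj; rewrite bv; case: (val a).
by rewrite -surjective_pairing (valP a).
Qed.

Lemma subdiv_ptn (a : edge G) : subdiv_pt n a n = inl (val a).2.
Proof.
rewrite /subdiv_pt; case: eqP n_gt0 => [-> //|_ _].
by case: insubP => //= j; rewrite ltnn.
Qed.

Lemma subdiv_pt_inner (a : edge G) i : 0 < i -> i < n ->
  exists2 j : 'I_n.-1, nat_of_ord j = i.-1 & subdiv_pt n a i = inr (a, j).
Proof.
move=> i_gt0 i_n; rewrite /subdiv_pt; case: eqP i_gt0 => [-> //|_ i_gt0].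
have lt : i.-1 < n.-1 by rewrite -subn1 -(subn1 n) ltn_sub2r //; apply: leq_trans i_n.
by exists (Ordinal lt); rewrite // insubT.
Qed.

Lemma spt0 v w : adj v w -> spt v w 0 = inl v.
Proof.
case/edgeP=> -[a av ->]; first by rewrite /subdiv_pt /= av.
by rewrite subn0 subdiv_ptn av.
Qed.

Lemma spt_edge_rev (a : edge G) i :
  spt (val a).2 (val a).1 i = subdiv_pt n a (n - i).
Proof.
rewrite /spt; case: insubP => [b _ bv|_].
  have /andP[_ +] := valP a; have /andP[_ +] := valP b.
  by rewrite bv /= => /ltnW; rewrite leqNgt => /negbTE ->.
by rewrite -surjective_pairing valK.
Qed.

Lemma spt_rev v w i : adj v w -> i <= n -> spt w v i = spt v w (n - i).
Proof.
move=> vw i_n; case/edgeP: (vw) => -[a av ->].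
  by rewrite -spt_edge_rev av.
by rewrite subKn // -spt_edge av.
Qed.

Lemma spt_inner v w i : adj v w -> 0 < i -> i < n ->
  exists2 a : edge G, (exists j : 'I_n.-1, spt v w i = inr (a, j)) &
    (val a = (v, w) \/ val a = (w, v)).
Proof.
move=> vw i_gt0 i_n; case/edgeP: (vw) => -[a av ->]; exists a.
- by have [j _ ->] := subdiv_pt_inner a i_gt0 i_n; exists j.
- by left.
- have [||j _ ->] := @subdiv_pt_inner a (n - i); [lia|lia|by exists j].
- by right.
Qed.

Lemma sptn v w : adj v w -> spt v w n = inl w.
Proof. by move=> vw; rewrite spt_rev ?subnn ?spt0 // adj_sym. Qed.

Lemma spt_inl v w i u : adj v w -> i <= n -> spt v w i = inl u ->
  (i = 0 /\ u = v) \/ (i = n /\ u = w).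
Proof.
move=> vw; rewrite leq_eqVlt => /orP[/eqP ->|i_n].
  by rewrite sptn // => -[->]; right.
case: (posnP i) => [->|i_gt0]; first by rewrite spt0 // => -[->]; left.
by have [a [j ->]] := spt_inner vw i_gt0 i_n.
Qed.

Lemma spt_inj v w i v' w' j : adj v w -> adj v' w' -> 0 < i -> i < n ->
  j <= n -> spt v w i = spt v' w' j ->
  [/\ v' = v, w' = w & j = i] \/ [/\ v' = w, w' = v & j = n - i].
Proof.
move=> vw vw' i_gt0 i_n j_n.
have [j0|j_gt0] := posnP j.
  by have [a [l ->] _] := spt_inner vw i_gt0 i_n; rewrite j0 spt0.
have [jn|j_neq] := eqVneq j n.
  by have [a [l ->] _] := spt_inner vw i_gt0 i_n; rewrite jn sptn.
have {j_n j_neq} j_n : j < n by lia.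
have inner (b : edge G) l : 0 < l -> l < n -> exists2 j : 'I_n.-1, nat_of_ord j = l.-1 &
    subdiv_pt n b l = inr (b, j) by exact: subdiv_pt_inner.
case/edgeP: vw => -[a av ->]; case/edgeP: vw' => -[b bv ->].
- have [p ep ->] := inner a i i_gt0 i_n; have [q eq ->] := inner b j j_gt0 j_n.
  by case=> e1 e2; left; move: av; rewrite e1 bv => -[-> ->]; rewrite e2 in ep; split=> //; lia.
- have [p ep ->] := inner a i i_gt0 i_n.
  have [||q eq ->] := inner b (n - j); [lia|lia|].
  by case=> e1 e2; right; move: av; rewrite e1 bv => -[-> ->]; rewrite e2 in ep; split=> //; lia.
- have [q eq ->] := inner b j j_gt0 j_n.
  have [||p ep ->] := inner a (n - i); [lia|lia|].
  by case=> e1 e2; right; move: av; rewrite e1 bv => -[-> ->]; rewrite e2 in ep; split=> //; lia.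
- have [||p ep ->] := inner a (n - i); [lia|lia|].
  have [||q eq ->] := inner b (n - j); [lia|lia|].
  by case=> e1 e2; left; move: av; rewrite e1 bv => -[-> ->]; rewrite e2 in ep; split=> //; lia.
Qed.

Lemma subdiv_adj_spt x y : @subdiv_adj G n x y ->
  exists v w i, [/\ adj v w, i < n, x = spt v w i & y = spt v w i.+1].
Proof.
case/existsP=> a /existsP[i]; have va := edge_adj a; have i_n := ltn_ord i.
case/orP=> /andP[/eqP -> /eqP ->].
  by exists (val a).1, (val a).2, i; rewrite !spt_edge.
exists (val a).2, (val a).1, (n - i.+1); rewrite adj_sym va !spt_edge_rev.
by split=> //; [lia|congr subdiv_pt; lia|congr subdiv_pt; lia].
Qed.

Lemma spt_adj v w i : adj v w -> i < n ->
  @subdiv_adj G n (spt v w i) (spt v w i.+1).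
Proof.
move=> vw i_n; case/edgeP: (vw) => -[a _ e]; rewrite !e.
  by apply/existsP; exists a; apply/existsP; exists (Ordinal i_n); rewrite !eqxx.
have lt : n - i.+1 < n by lia.
apply/existsP; exists a; apply/existsP; exists (Ordinal lt) => /=.
by rewrite -subnSK // !eqxx orbT.
Qed.

Inductive near t x y : Prop :=
| NearEdge v w i j of adj v w & i <= n & j <= n & x = spt v w i &
    y = spt v w j & i <= j + t & j <= i + t
| NearVertex v w w' i j of adj v w & adj v w' & i <= n & j <= n &
    x = spt v w i & y = spt v w' j & i + j <= t.

(** Distinct vertices of [G] are at least [n] steps apart, so a shorter walk stays on one edge or
    turns around a single vertex of [G]. The induction appends one step to the walk. *)
Lemma near_path x p : size p < n -> path (@subdiv_adj G n) x p ->
  last x p = x \/ near (size p) x (last x p).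
Proof.
elim/last_ind: p => [|p y' IH] //=; first by left.
rewrite size_rcons rcons_path last_rcons => szp /andP[px yy'].
have {IH} := IH (ltnW szp) px; move: yy'; set y := last x p; set t := size p.
move=> /subdiv_adj_spt[a [b [l [ab l_n ey ey']]]] [yx|near_xy].
  right; rewrite ey' -yx ey.
  by apply: (@NearEdge _ _ _ a b l l.+1) => //; [exact: ltnW|lia|lia].
right.
have l0 u : inl u = y -> l = 0 /\ a = u.
  move/esym; rewrite ey => /spt_inl[||[-> ->]|[eln _]] //; first exact: ltnW.
  by rewrite eln ltnn in l_n.
have pos j : j <= n -> [\/ j = 0, j = n | 0 < j /\ j < n].
  by case: (posnP j) => [->|j0]; [constructor 1|rewrite leq_eqVlt => /orP[/eqP|]; [constructor 2|constructor 3]].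
case: near_xy => [v w i j vw i_n j_n ex ej ij ji | v w w' i j vw vw' i_n j_n ex ej ij].
- case: (pos j j_n) => [j0|jn|[j_gt0 jn]].
  + have [el ea] : l = 0 /\ a = v by apply: l0; rewrite ej j0 spt0.
    rewrite {}el {}ea in ab ey' *.
    by apply: (@NearVertex _ _ _ v w b i 1) => //; lia.
  + have [el ea] : l = 0 /\ a = w by apply: l0; rewrite ej jn sptn.
    rewrite {}el {}ea in ab ey' *.
    apply: (@NearVertex _ _ _ w v b (n - i) 1) => //; rewrite ?(adj_sym w) //; try lia.
    by rewrite spt_rev ?subKn //; lia.
  + move: ey; rewrite ej => /spt_inj[] //; first exact: ltnW.
      move=> [e1 e2 e3]; rewrite {}e1 {}e2 {}e3 in ey'.
      by apply: (@NearEdge _ _ _ v w i j.+1) => //; lia.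
    move=> [e1 e2 e3]; rewrite {}e1 {}e2 {}e3 in ey'.
    apply: (@NearEdge _ _ _ v w i j.-1) => //; try lia.
    by rewrite ey' spt_rev //; [congr spt; lia|lia].
- case: (pos j j_n) => [j0|jn|[j_gt0 jn]].
  + have [el ea] : l = 0 /\ a = v by apply: l0; rewrite ej j0 spt0.
    rewrite {}el {}ea in ab ey' *.
    by apply: (@NearVertex _ _ _ v w b i 1) => //; lia.
  (* Reaching a second vertex of [G] would take at least [n] steps. *)
  + by rewrite jn in ij; have := leq_trans (leq_addl i n) ij; rewrite leqNgt (ltnW szp).
  + move: ey; rewrite ej => /spt_inj[] //; first exact: ltnW.
      move=> [e1 e2 e3]; rewrite {}e1 {}e2 {}e3 in ey'.
      by apply: (@NearVertex _ _ _ v w w' i j.+1) => //; lia.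
    move=> [e1 e2 e3]; rewrite {}e1 {}e2 {}e3 in ey'.
    apply: (@NearVertex _ _ _ v w w' i j.-1) => //; try lia.
    by rewrite ey' spt_rev //; [congr spt; lia|lia].
Qed.

Lemma spt_path v w i : adj v w -> i <= n ->
  exists p, [/\ path (@subdiv_adj G n) (inl v) p, last (inl v) p = spt v w i & size p = i].
Proof.
move=> vw; elim: i => [|i IH] i_n; first by exists [::]; rewrite spt0.
have [p [pp lp sp]] := IH (ltnW i_n); exists (rcons p (spt v w i.+1)).
by rewrite rcons_path last_rcons size_rcons pp lp sp spt_adj.
Qed.

Lemma vertex_ball_adj m v w w' i j : adj v w -> adj v w' -> i <= n -> j <= n ->
  i + j <= m -> spt v w i != spt v w' j ->
  @power_adj (subdivision G n) m (spt v w i) (spt v w' j).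
Proof.
move=> vw vw' i_n j_n ij ne.
have [p [pp lp sp]] := spt_path vw i_n; have [q [pq lq sq]] := spt_path vw' j_n.
have : @walk (subdivision G n) (spt v w i) (inl v) i.
  rewrite walk_sym; apply/existsP; have sz : size p == i by rewrite sp.
  by exists (Tuple sz); rewrite /= pp lp eqxx.
case/existsP=> r /andP[pr /eqP lr].
apply: (@power_adj_path _ _ _ _ (r ++ q)) => //.
- by rewrite cat_path pr lr.
- by rewrite last_cat lr.
- by rewrite size_cat size_tuple sq.
Qed.

(** Any two points of the ball are joined through [v] by at most [2 k] steps; as [k < n], the
    branches meet only in [v]. *)
Lemma ball_clique_number k v : k < n ->
  k * #|[set w | adj v w]| < clique_number (fractional_power G k.*2 n).
Proof.
move=> k_n; set N := [set w | adj v w].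
pose B := [set spt v u.1 (nat_of_ord u.2).+1 | u in setX N [set: 'I_k]].
have BP x : x \in B -> exists w i, [/\ adj v w, 0 < i, i <= k & x = spt v w i].
  case/imsetP=> -[w i]; rewrite !inE andbT /= => vw ->.
  by exists w, i.+1; rewrite vw ltn_ord.
have cardB : #|B| = k * #|N|.
  rewrite card_in_imset ?cardsX ?cardsT ?card_ord 1?mulnC //.
  move=> [w i] [w' j]; rewrite !inE !andbT /= => vw vw' e.
  have in_ := ltn_ord i; have jn_ := ltn_ord j.
  case: (spt_inj vw vw' _ _ _ e); [by []|lia|lia| |].
    by move=> [_ -> /succn_inj/val_inj ->].
  by move=> [ev _ _]; rewrite -ev adj_irrefl in vw.
have vB : inl v \notin B.
  apply/negP=> /BP[w [i [vw i0 ik]]] /esym/spt_inl[||[ei _]|[ei _]] //; lia.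
have clA : @clique (fractional_power G k.*2 n) (inl v |: B).
  have PB x : x \in inl v |: B -> x = inl v \/ exists w i, [/\ adj v w, i <= k & x = spt v w i].
    case/setU1P => [->|/BP[w [i [vw _ ik ->]]]]; [by left|right].
    by exists w, i.
  apply/forall_inP => x /PB xB; apply/forall_inP => y /PB yB; apply/implyP => xy.
  have [[w [i [vw ik ex]]] | x0] : (exists w i, [/\ adj v w, i <= k & x = spt v w i]) \/
      x = inl v /\ exists w j, [/\ adj v w, j <= k & y = spt v w j].
    case: xB => [x0|]; last by left.
    by case: yB xy => [->|]; [rewrite x0 eqxx|right].
  - case: yB => [y0|[w' [j [vw' jk ey]]]]; rewrite /= ex in xy *.
      by rewrite y0 -(spt0 vw) in xy *; apply: vertex_ball_adj => //; lia.
    by rewrite ey in xy *; apply: vertex_ball_adj => //; lia.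
  - case: x0 => x0 [w [j [vw jk ey]]].
    by move: xy; rewrite x0 ey -(spt0 vw) => xy; apply: vertex_ball_adj => //; lia.
rewrite -cardB; have <- : #|inl v |: B| = #|B|.+1 by rewrite cardsU1 vB.
exact: (@leq_bigmax_cond _ (fun A => clique A) (fun A : {set fractional_power G k.*2 n} => #|A|)).
Qed.

(* [F v w i] is the color of the vertex at distance [i] from [v] on [vw]. *)
Definition edge_coloring N m (F : G -> G -> nat -> nat) :=
  [/\ forall v w i, adj v w -> i <= n -> F v w i < N /\ F w v i = F v w (n - i),
      forall v w w', adj v w -> adj v w' -> F v w 0 = F v w' 0,
      forall v w i j, adj v w -> i < j -> j <= n -> j <= i + m -> F v w i <> F v w j &
      forall v w w' i j, adj v w -> adj v w' -> w <> w' -> 0 < i -> 0 < j ->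
        i + j <= m -> F v w i <> F v w' j].

(** By [near_path], adjacent vertices of the power lie on one edge or around one vertex, and there
    the conditions of [edge_coloring] separate them. *)
Lemma edge_coloring_colorable N m F : m < n -> edge_coloring N.+1 m F ->
  colorable (fractional_power G m n) N.+1.
Proof.
move=> m_n [symF cenF edgeF vertF].
(* All edges at [v] agree at position 0, so any neighbor will do. An isolated vertex gets the color
   0, hence the nonempty palette [N.+1]. *)
pose c (x : subdiv_vertex G n) := match x with
  | inl v => if [pick w | adj v w] is Some w then F v w 0 else 0
  | inr (a, j) => F (val a).1 (val a).2 j.+1 end.
have cE v w i : adj v w -> i <= n -> c (spt v w i) = F v w i.
  have c0 v1 w1 : adj v1 w1 -> c (inl v1) = F v1 w1 0.
    by move=> vw /=; case: pickP => [w2 vw2|/(_ w1)]; [apply: cenF|rewrite vw].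
  move=> vw; rewrite leq_eqVlt => /orP[/eqP ->|i_n].
    by rewrite sptn // (c0 w v) ?(symF v w 0 vw (leq0n n)).2 ?subn0 // adj_sym.
  case: (posnP i) => [->|i_gt0]; first by rewrite spt0 //; exact: c0.
  case/edgeP: (vw) => -[a av ->].
    by have [j ej ->] := subdiv_pt_inner a i_gt0 i_n; rewrite /= av /= ej prednK.
  have [||j ej ->] := @subdiv_pt_inner a (n - i); [lia|lia|].
  rewrite /= av /= ej prednK; last by lia.
  by rewrite (symF v w _ vw (leq_subr i n)).2 subKn // ltnW.
have c_lt x : c x < N.+1.
  case: x => [v|[a j]] /=.
    by case: pickP => // w vw; case: (symF v w 0 vw (leq0n n)).
  have jn : j.+1 <= n by have := ltn_ord j; move: (nat_of_ord j) => j'; lia.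
  by case: (symF _ _ j.+1 (edge_adj a) jn).
have c_neq x y : x != y -> near m x y -> c x <> c y.
  move=> xy [v w i j vw i_n j_n ex ey ij ji | v w w' i j vw vw' i_n j_n ex ey ij].
    rewrite ex ey !cE //; case: (ltngtP i j) => [lt|lt|eq].
    - by apply: edgeF.
    - by move/esym; apply: edgeF.
    - by move: xy; rewrite ex ey eq eqxx.
  (* [vertF] does not speak of the center; [cenF] moves a pair containing it onto one edge. *)
  rewrite ex ey !cE //; case: (posnP i) => [i0|i_gt0].
    rewrite i0 (cenF _ _ _ vw vw'); apply: edgeF => //; last by lia.
    by case: (posnP j) xy => // j0; rewrite ex ey i0 j0 !spt0 ?eqxx.
  case: (posnP j) => [j0|j_gt0].
    by rewrite j0 (cenF _ _ _ vw' vw); move/esym; apply: edgeF => //; lia.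
  have [eq|/eqP neq] := eqVneq w w'; last exact: vertF.
  rewrite -eq; case: (ltngtP i j) => [lt|lt|eq'].
  - by apply: edgeF => //; lia.
  - by move/esym; apply: edgeF => //; lia.
  - by move: xy; rewrite ex ey eq eq' eqxx.
apply/existsP; exists [ffun x => Ordinal (c_lt x)]; apply/forallP=> x.
apply/forallP=> y; apply/implyP=> xy; rewrite !ffunE; apply/eqP => -[].
apply: c_neq; first by case/and3P: xy.
have [p [pp lp sp]] := power_adj_walk xy.
have [|e|nr] := near_path _ pp; first exact: leq_ltn_trans m_n.
  by move: xy; rewrite -lp e /= power_adj_irrefl.
rewrite -lp; case: nr => [v w i j vw i_n j_n ex ey ij ji|v w w' i j vw vw' i_n j_n ex ey ij].
  apply: (@NearEdge _ _ _ v w i j) => //.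
    by apply: leq_trans ij _; rewrite leq_add2l.
  by apply: leq_trans ji _; rewrite leq_add2l.
by apply: (@NearVertex _ _ _ v w w' i j) => //; exact: leq_trans ij sp.
Qed.

End Subdivision.

(* The color sequence of each edge is prolonged by repeating its first [m + 1]
   terms. *)
Lemma edge_coloring_extend G n N m F : m < n -> @edge_coloring G n N m F ->
  exists F', @edge_coloring G (n + m.+1) N m F'.
Proof.
move=> m_n [symF cenF edgeF vertF].
(* The jump back by [m.+1] comes after position [m] seen from one end and after position [n] seen
   from the other, which keeps the coloring symmetric. *)
pose t (v w : G) := if enum_rank v < enum_rank w then m else n.
have tC v w : adj v w -> t v w + t w v = m + n /\ m <= t v w <= n.
  move=> vw; rewrite /t; case: ltngtP => [||/val_inj/enum_rank_inj e] //; try lia.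
  by rewrite e adj_irrefl in vw.
pose F' (v w : G) i := if i <= t v w then F v w i else F v w (i - m.+1).
exists F'; split.
- move=> v w i vw i_n; have [tvw /andP[mt tn]] := tC v w vw.
  have bnd j : j <= n -> F v w j < N by move=> jn; case: (symF v w j vw jn).
  split; first by rewrite /F'; case: (leqP i (t v w)) => h1; apply: bnd; lia.
  have {}symF j l : j + l = n -> F w v j = F v w l.
    move=> jl; case: (symF v w j vw) => [|_ ->]; [lia|congr F; lia].
  rewrite /F'; case: leqP => h1; case: leqP => h2; try lia.
  - by apply: symF; lia.
  - by apply: symF; lia.
- by move=> v w w' vw vw'; rewrite /F' !leq0n; apply: cenF.
- move=> v w i j vw ij j_n jim; have [tvw /andP[mt tn]] := tC v w vw.
  rewrite /F'; case: leqP => h1; case: leqP => h2; try lia.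
  - by apply: edgeF => //; lia.
  (* Across the jump, the pair becomes [j - m.+1 < i], still at distance at most [m]. *)
  - by move/esym; apply: edgeF => //; lia.
  - by apply: edgeF => //; lia.
- move=> v w w' i j vw vw' ww' i0 j0 ij.
  have [_ /andP[mt _]] := tC v w vw; have [_ /andP[mt' _]] := tC v w' vw'.
  rewrite /F' !ifT; [exact: vertF|lia|lia].
Qed.

(** * Labels with distinct letters on each edge *)

Definition letter := option bool.

Definition lrot (a : letter) : letter :=
  if a is Some b then if b then None else Some true else Some false.

(* The letter different from [a] and [b], when these are distinct. *)
Definition third (a b : letter) : letter :=
  match a, b with
  | None, Some x | Some x, None => Some (~~ x)
  | _, _ => None
  end.

Section ThreeLeaves.
Variables (T : finType) (e : rel T).
Hypothesis e_sym : symmetric e.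
Hypothesis e_deg2 : forall x y1 y2 y3, e x y1 -> e x y2 -> e x y3 ->
  [\/ y1 = y2, y1 = y3 | y2 = y3].

Definition leaf x := forall y1 y2, e x y1 -> e x y2 -> y1 = y2.

(** A repetition-free path from [x] to [y] is closed under adjacency: its inner vertices have both
    their neighbors on it, and its ends are leaves. So [z] would be an inner vertex, with two
    distinct neighbors. *)
Lemma three_leaves x y z : x != y -> z != x -> z != y ->
  leaf x -> leaf y -> leaf z -> connect e x y -> ~~ connect e x z.
Proof.
move=> xy zx zy lx ly lz /connectP[p0 pp0 ep0].
case/shortenP: pp0 ep0 => p pp up _ ep {p0}.
have split_in v : v \in p -> v != y -> exists u w, [/\ u \in x :: p, w \in x :: p, u != w, e v u & e v w].
  move=> vp vy; case/splitPr: vp pp up ep => p1 [|w p2].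
    by rewrite last_cat /= => _ _ yv; rewrite yv eqxx in vy.
  move=> pp; rewrite -cat_cons cat_uniq => /and3P[_ nh _] _.
  move: pp; rewrite cat_path /= => /and4P[_ ev vw _].
  exists (last x p1), w; split=> //; last by rewrite e_sym.
  - by rewrite -cat_cons mem_cat mem_last.
  - by rewrite -cat_cons mem_cat !inE eqxx !orbT.
  - apply: contraNneq nh => <-; apply/hasP; exists (last x p1) => /=; last exact: mem_last.
    by rewrite !inE eqxx orbT.
have clos v w : e v w -> (v \in x :: p) -> (w \in x :: p).
  move=> vw; rewrite inE => /orP[/eqP vx|vp].
    case: p pp ep {up split_in} => [|u p] /=; first by move=> _ yx; rewrite yx eqxx in xy.
    by case/andP=> xu _ _; rewrite (lx w u) ?inE ?eqxx ?orbT // -vx.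
  have [vy|vy] := eqVneq v y; last first.
    have [u1 [u2 [in1 in2 u12 e1 e2]]] := split_in v vp vy.
    case: (e_deg2 vw e1 e2) => [->|->|eq] //; by rewrite eq eqxx in u12.
  case/lastP: p pp ep vp {split_in up} => [|q u] //.
  rewrite rcons_path last_rcons => /andP[_ qu] eu _.
  rewrite (ly w (last x q)) -?vy //; first by rewrite -rcons_cons mem_rcons inE mem_last orbT.
  by rewrite vy eu e_sym.
apply/negP => /connectP[q].
have : x \in x :: p by rewrite mem_head.
elim: q {1 3 4}x => [|w q IH] v vin /= => [_ zv|/andP[vw wq]]; last first.
  by apply: IH => //; apply: clos vw vin.
move: vin; rewrite -zv inE (negPf zx) /= => zp.
have [u1 [u2 [_ _ u12 e1 e2]]] := split_in z zp zy.
by rewrite (lz _ _ e1 e2) eqxx in u12.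
Qed.

End ThreeLeaves.

Section TwistedLabelling.
Variable G : sgraph.
Hypothesis deg3 : forall v : G, #|[set w | adj v w]| <= 3.
Implicit Types (X : {set G}) (h : G -> G -> letter) (b : G -> letter -> bool).

(* [h v w] labels the half-edge at [v] of the edge [vw]. *)
Definition locally_inj h v :=
  forall w w' : G, adj v w -> adj v w' -> h v w = h v w' -> w = w'.

Definition twisted X h b :=
  (forall v, v \in X -> locally_inj h v) /\
  (forall v w, v \in X -> w \in X -> adj v w -> h v w <> h w v /\
     b v (third (h v w) (h w v)) <> b w (third (h v w) (h w v))).

(** The edges whose ends must have different bits for [c]. Bits for [c] can therefore be flipped on
    whole components only. *)
Definition link X h c : rel G := fun v w =>
  [&& v \in X, w \in X, adj v w & third (h v w) (h w v) == c].

Lemma thirdC x y : third x y = third y x.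
Proof. by case: x y => [[]|] [[]|]. Qed.

Lemma third_neq x y : x <> y -> (third x y <> x) * (third x y <> y).
Proof. by case: x y => [[]|] [[]|]. Qed.

Lemma link_sym X h c : symmetric (link X h c).
Proof. by move=> v w; rewrite /link thirdC adj_sym andbCA. Qed.

(** The half-edges at [v] of these edges avoid [c], so only two letters remain for them. *)
Lemma link_deg2 X h b c v w1 w2 w3 : twisted X h b ->
  link X h c v w1 -> link X h c v w2 -> link X h c v w3 ->
  [\/ w1 = w2, w1 = w3 | w2 = w3].
Proof.
move=> [inj ok] /and4P[vX w1X v1 /eqP t1] /and4P[_ w2X v2 /eqP t2] /and4P[_ w3X v3 /eqP t3].
have inj_v := inj v vX.
have := third_neq (ok v w1 vX w1X v1).1; have := third_neq (ok v w2 vX w2X v2).1.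
have := third_neq (ok v w3 vX w3X v3).1; rewrite t1 t2 t3 => -[n3 _] [n2 _] [n1 _].
have : [\/ h v w1 = h v w2, h v w1 = h v w3 | h v w2 = h v w3].
  move: n1 n2 n3; case: (c) (h v w1) (h v w2) (h v w3) => [[]|] [[]|] [[]|] [[]|] // *;
  by [constructor 1|constructor 2|constructor 3].
by case=> e; [constructor 1|constructor 2|constructor 3]; apply: inj_v.
Qed.

(** The half-edge towards [r] already takes one of the two letters other than [c]. *)
Lemma link_leaf X h b c r u : twisted X h b -> r \notin X -> adj u r ->
  h u r <> c -> leaf (link X h c) u.
Proof.
move=> [inj ok] rX ur hc w1 w2 /and4P[uX w1X u1 /eqP t1] /and4P[_ w2X u2 /eqP t2].
have inj_u := inj u uX.
have := third_neq (ok u w1 uX w1X u1).1; have := third_neq (ok u w2 uX w2X u2).1.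
rewrite t1 t2 => -[n2 _] [n1 _]; apply: (inj_u) => //.
have n3 : h u r <> h u w1 by move/(inj_u _ _ ur u1) => e; rewrite e w1X in rX.
have n4 : h u r <> h u w2 by move/(inj_u _ _ ur u2) => e; rewrite e w2X in rX.
move: hc n1 n2 n3 n4.
by case: (c) (h u w1) (h u w2) (h u r) => [[]|] [[]|] [[]|] [[]|].
Qed.

Definition flip X h b c u : G -> letter -> bool := fun v x =>
  if (x == c) && connect (link X h c) u v then ~~ b v x else b v x.

Lemma twisted_flip X h b c u : twisted X h b -> twisted X h (flip X h b c u).
Proof.
move=> [inj ok]; split=> // v w vX wX vw; have [ne nb] := ok v w vX wX vw.
split=> //; rewrite /flip; case: eqP => //= tc.
have l : link X h c v w by rewrite /link vX wX vw tc eqxx.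
have -> : connect (link X h c) u v = connect (link X h c) u w.
  by apply: same_connect_r; [exact/sym_connect_sym/link_sym|exact: connect1].
by case: ifP => _ // /negb_inj.
Qed.

(* The vertices [u1], [u2] and [u3] are leaves of the graph [link X h c], which
   consists of paths and cycles, so they are not all in the same component. *)
Lemma align_bits X h b c r u1 u2 u3 : twisted X h b -> r \notin X ->
  adj r u1 -> adj r u2 -> adj r u3 -> u1 != u2 -> u1 != u3 -> u2 != u3 ->
  h u1 r <> c -> h u2 r <> c -> h u3 r <> c ->
  exists2 b', twisted X h b' & b' u1 c = b' u3 c \/ b' u2 c = b' u3 c.
Proof.
move=> tw rX r1 r2 r3 u12 u13 u23 h1 h2 h3.
have [|n1] := eqVneq (b u1 c) (b u3 c); first by exists b => //; left.
have [|n2] := eqVneq (b u2 c) (b u3 c); first by exists b => //; right.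
have lf u : adj r u -> h u r <> c -> leaf (link X h c) u.
  by rewrite adj_sym => ur hu; apply: (link_leaf tw rX ur).
have cs := sym_connect_sym (link_sym X h c).
have [c31|c31] := boolP (connect (link X h c) u3 u1).
  have c32 : ~~ connect (link X h c) u3 u2.
    apply: three_leaves c31; rewrite ?(eq_sym u3) //; try by apply: lf.
    - exact: link_sym.
    - by move=> *; apply: link_deg2; eassumption.
    - by rewrite eq_sym.
  exists (flip X h b c u2); first exact: twisted_flip.
  right; rewrite /flip eqxx connect0 /= cs (negPf c32).
  by move: n2; case: (b u2 c) (b u3 c) => [] [].
exists (flip X h b c u1); first exact: twisted_flip.
left; rewrite /flip eqxx connect0 /= cs (negPf c31).
by move: n1; case: (b u1 c) (b u3 c) => [] [].
Qed.

(* [None] stands for a missing pendant label, which [p] may choose freely. *)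
Lemma pendant_cases (q : letter -> option letter) :
  (exists i, q i = None) \/ (exists i j, q i <> q j) ->
  exists2 p : letter -> letter, (forall i a, q i = Some a -> p i = a) &
    injective p \/
    exists i j l, [/\ uniq [:: i; j; l], p i = p j & p l <> p i].
Proof.
move=> qP; pose p0 a0 a1 a2 (i : letter) : letter :=
  if i is Some b then if b then a1 else a0 else a2.
have cov a0 a1 a2 : (a0 <> a1 \/ a1 <> a2) -> injective (p0 a0 a1 a2) \/
    exists i j l, [/\ uniq [:: i; j; l], p0 a0 a1 a2 i = p0 a0 a1 a2 j &
      p0 a0 a1 a2 l <> p0 a0 a1 a2 i].
  have [<- [//|n]|n01] := eqVneq a0 a1.
    by right; exists (Some false), (Some true), None; split=> //= /esym.
  have [e12 _|n12 _] := eqVneq a1 a2.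
    by right; exists (Some true), None, (Some false); split=> //=; exact/eqP.
  have [e02|n02] := eqVneq a0 a2.
    right; exists (Some false), None, (Some true); split=> //=.
    by apply/eqP; rewrite eq_sym.
  left=> -[[]|] [[]|] //= /eqP; rewrite ?(negPf n01) ?(negPf n12) ?(negPf n02) //.
  - by rewrite eq_sym (negPf n01).
  - by rewrite eq_sym (negPf n12).
  - by rewrite eq_sym (negPf n02).
(* Missing labels are filled in, by [lrot] of a present one if any, so that the three are not all
   equal. *)
have [a0 [a1 [a2 [n e]]]] : exists a0 a1 a2, (a0 <> a1 \/ a1 <> a2) /\
    forall i a, q i = Some a -> p0 a0 a1 a2 i = a.
  have nr a : lrot a <> a by case: a => [[]|].
  case e0: (q (Some false)) => [a0|]; case e1: (q (Some true)) => [a1|];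
    case e2: (q None) => [a2|].
  - have [|n01] := eqVneq a0 a1; last first.
      by exists a0, a1, a2; split; [left; exact/eqP|move=> [[]|] a /=; rewrite ?e0 ?e1 ?e2 => -[]].
    have [|n12] := eqVneq a1 a2; last first.
      by exists a0, a1, a2; split; [right; exact/eqP|move=> [[]|] a /=; rewrite ?e0 ?e1 ?e2 => -[]].
    move=> a12 a01; subst a2 a1; by case: qP => [[[[]|]]|[[[]|] [[[]|]]]] //; rewrite ?e0 ?e1 ?e2.
  - exists a0, a1, (lrot a1); split; first by right=> /esym/nr.
    by move=> [[]|] a /=; rewrite ?e0 ?e1 ?e2 => -[].
  - exists a0, (lrot a0), a2; split; first by left=> /esym/nr.
    by move=> [[]|] a /=; rewrite ?e0 ?e1 ?e2 => -[].
  - exists a0, (lrot a0), None; split; first by left=> /esym/nr.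
    by move=> [[]|] a /=; rewrite ?e0 ?e1 ?e2 => -[].
  - exists (lrot a1), a1, a2; split; first by left=> /nr.
    by move=> [[]|] a /=; rewrite ?e0 ?e1 ?e2 => -[].
  - exists (lrot a1), a1, None; split; first by left=> /nr.
    by move=> [[]|] a /=; rewrite ?e0 ?e1 ?e2 => -[].
  - exists None, (lrot a2), a2; split; first by right=> /nr.
    by move=> [[]|] a /=; rewrite ?e0 ?e1 ?e2 => -[].
  - exists None, (lrot None), None; split; first by left.
    by move=> [[]|] a /=; rewrite ?e0 ?e1 ?e2 => -[].
by exists (p0 a0 a1 a2) => //; exact: cov.
Qed.

Lemma slots (r : G) : exists t : G -> letter,
  forall w w', adj r w -> adj r w' -> t w = t w' -> w = w'.
Proof.
pose N := [set w | adj r w].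
have lt w : index w (enum N) < 3 \/ ~~ adj r w.
  have [rw|] := boolP (adj r w); [left|by right].
  by apply: leq_trans (deg3 r); rewrite -/N cardE index_mem mem_enum inE.
pose f (i : nat) : letter := nth None [:: Some false; Some true] i.
exists (fun w => f (index w (enum N))) => w w' rw rw' e.
have wN : w \in enum N by rewrite mem_enum inE.
have w'N : w' \in enum N by rewrite mem_enum inE.
apply: (@index_inj _ w (enum N)) => //.
case: (lt w) => [|/negP//]; case: (lt w') => [|/negP//].
by move: e; case: (index w _) => [|[|[|]]] //; case: (index w' _) => [|[|[|]]].
Qed.

Definition bits_consistent X r (c : G -> letter) b :=
  forall w w', adj r w -> adj r w' -> w \in X -> w' \in X ->
    c w = c w' -> b w (c w) = b w' (c w).

(** The bit of [r] for a letter must be opposite to the bits of all neighbors whose edge has this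
    third letter, so it can be chosen as soon as these agree; an unconstrained bit is set to
    [true]. *)
Lemma twisted_extend_labels X h b r (l : G -> letter) :
  twisted X h b -> r \notin X ->
  (forall w w', adj r w -> adj r w' -> l w = l w' -> w = w') ->
  (forall w, adj r w -> w \in X -> l w <> h w r) ->
  bits_consistent X r (fun w => third (l w) (h w r)) b ->
  exists h' b', twisted (r |: X) h' b' /\ {in X, forall v, h' v = h v}.
Proof.
move=> [inj ok] rX linj lneq cons.
pose h' v := if v == r then l else h v.
pose b' v c := if v == r then
    if [pick w | [&& adj r w, w \in X & third (l w) (h w r) == c]] is Some w
    then ~~ b w c else true
  else b v c.
have hX v : v \in X -> (v == r) = false.
  by move=> vX; apply: contraNF rX => /eqP <-.
have edge_r w : w \in X -> adj r w -> l w <> h w r /\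
    b' r (third (l w) (h w r)) <> b w (third (l w) (h w r)).
  move=> wX rw; split; first exact: lneq.
  rewrite /b' eqxx; case: pickP => [w' /and3P[rw' w'X /eqP e]|/(_ w)].
    rewrite -e (cons w' w) // e.
    by case: (b w _).
  by rewrite rw wX eqxx.
exists h', b'; split; last by move=> v vX; rewrite /h' hX.
split=> [v|v w].
  case/setU1P => [->|vX]; first by move=> w w'; rewrite /h' eqxx; apply: linj.
  by move=> w w'; rewrite /h' hX //; apply: inj.
case/setU1P => [->|vX] /setU1P[->|wX]; rewrite ?adj_irrefl // => vw.
- by rewrite /h' eqxx hX // {2}/b' hX //; exact: edge_r.
- rewrite adj_sym in vw; have [e1 e2] := edge_r v vX vw.
  by rewrite /h' eqxx hX // {1}/b' hX // thirdC; split=> /esym.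
- by rewrite /h' /b' !hX //; apply: ok.
Qed.

Lemma lrot_neq a : lrot a <> a.
Proof. by case: a => [[]|]. Qed.

Lemma third_lrot_inj x y : third (lrot x) x = third (lrot y) y -> x = y.
Proof. by case: x y => [[]|] [[]|]. Qed.

(** If the pendant labels are distinct, [r] uses their rotations: the third letters are then
    distinct and the bits unconstrained. Otherwise two slots carry [a] and one carries [e != a], and
    only two neighbors have to agree on a bit, which [align_bits] achieves. *)
Lemma twisted_add X h b r : twisted X h b -> r \notin X ->
  (exists2 a, adj r a & a \notin X) \/ #|[set w | adj r w]| < 3 \/
    (exists w w', [/\ adj r w, adj r w', w \in X, w' \in X & h w r <> h w' r]) ->
  exists h' b', twisted (r |: X) h' b' /\ {in X, forall v, h' v = h v}.
Proof.
move=> tw rX nstuck; have [t tinj] := slots r.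
pose at_slot i w := [&& adj r w, w \in X & t w == i].
pose q i := if [pick w | at_slot i w] is Some w then Some (h w r) else None.
have qt w : adj r w -> w \in X -> q (t w) = Some (h w r).
  move=> rw wX; rewrite /q; case: pickP => [w'|/(_ w)]; last by rewrite /at_slot rw wX eqxx.
  by move=> /and3P[rw' w'X /eqP /(tinj _ _ rw' rw) ->].
have [|p pq pP] := @pendant_cases q.
  case: nstuck => [[a ra aX]|[lt3|[w [w' [rw rw' wX w'X ne]]]]]; last first.
  - by right; exists (t w), (t w'); rewrite !qt // => -[].
  - left; have [i it] : exists i, i \notin t @: [set w | adj r w].
      apply/existsP; rewrite -negb_forall; apply: contraTN lt3 => /forallP full.
      have <- : #|[set: letter]| = 3 by rewrite cardsT card_option card_bool.
      rewrite -leqNgt; apply: leq_trans (leq_imset_card t _).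
      by rewrite subset_leq_card //; apply/subsetP => i _; exact: full.
    exists i; rewrite /q; case: pickP => // w /and3P[rw _ /eqP e].
    by case/imsetP: it; exists w; rewrite ?inE.
  - left; exists (t a); rewrite /q; case: pickP => // w /and3P[rw wX /eqP e].
    by rewrite (tinj _ _ rw ra e) (negPf aX) in wX.
have hp w : adj r w -> w \in X -> h w r = p (t w) by move=> rw wX; rewrite (pq _ _ (qt w rw wX)).
case: pP => [pinj|[i [j [l [uijl pij pli]]]]].
  apply: (@twisted_extend_labels _ _ _ _ (fun w => lrot (p (t w))) tw rX) => [w w' rw rw'|w rw wX|w w' rw rw' wX w'X].
  - move=> e; apply: tinj => //; apply: pinj; move: e.
    by case: (p _) (p _) => [[]|] [[]|].
  - by rewrite hp //; exact: lrot_neq.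
  - by rewrite !hp // => /third_lrot_inj/pinj/tinj -> .
set a := p i in pij pli *; set e := p l in pli *; set c := third a e.
have all_slots x : x \in [:: i; j; l].
  by move: uijl; case: (i) (j) (l) x => [[]|] [[]|] [[]|] [[]|].
(* The slots [l], [s], [s'] get the letters [a], [e], [c]. Their third letters are [c], [c], [e], so
   only the neighbors in slots [s] and [l] must agree, on the bit for [c]. An empty slot makes this
   vacuous. *)
have opt s s' b1 : uniq [:: s; s'; l] -> s \in [:: i; j] -> s' \in [:: i; j] ->
    twisted X h b1 ->
    (forall w w', adj r w -> adj r w' -> w \in X -> w' \in X -> t w = s -> t w' = l ->
      b1 w c = b1 w' c) ->
    exists h' b', twisted (r |: X) h' b' /\ {in X, forall v, h' v = h v}.
  rewrite /= !inE negb_or andbT => /andP[/andP[ss' sl] s'l] si s'i tw1 agree.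
  have ps : p s = a by case/orP: si => /eqP ->.
  have ps' : p s' = a by case/orP: s'i => /eqP ->.
  have cases x : [\/ x = s, x = s' | x = l].
    have := all_slots x; rewrite !inE => /or3P[]/eqP ->; last by constructor 3.
    - by case/orP: si ss' => /eqP ->; [constructor 1|case/orP: s'i => /eqP ->; [constructor 2|rewrite eqxx]].
    - by case/orP: si ss' => /eqP ->; [case/orP: s'i => /eqP ->; [rewrite eqxx|constructor 2]|constructor 1].
  pose f x := if x == l then a else if x == s then e else c.
  have fl : f l = a by rewrite /f eqxx.
  have fs : f s = e by rewrite /f (negPf sl) eqxx.
  have fs' : f s' = c by rewrite /f (negPf s'l) eq_sym (negPf ss').
  have [[nca nce] nca' nce'] : [/\ c <> a /\ c <> e, third c a = e & third e a = c].
    by move: pli; rewrite /c; case: (a) (e) => [[]|] [[]|].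
  have finj : injective f.
    move=> x y; case: (cases x) => ->; case: (cases y) => ->; rewrite ?fl ?fs ?fs' // => E;
      exfalso; move: nca nce pli E; clear; congruence.
  apply: (@twisted_extend_labels _ _ _ _ (fun w => f (t w)) tw1 rX) => [w w' rw rw'|w rw wX|w w' rw rw' wX w'X].
  - by move/finj; exact: tinj.
  - rewrite hp //; case: (cases (t w)) => ->; rewrite ?fl ?fs ?fs' ?ps ?ps' //.
    by move/esym.
  - rewrite !hp //; case: (cases (t w)) (cases (t w')) => ew [] ew';
    rewrite ew ew' ?fl ?fs ?fs' ?ps ?ps' -/e -/c ?nca' ?nce' => E;
      try (by rewrite (tinj w w') // ew ew'); try by case: nce.
    + exact: agree.
    + by symmetry; exact: agree.
have [/existsP[wi /and3P[ri iX /eqP ti]]|ni] := boolP [exists w, at_slot i w]; last first.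
  apply: (opt i j b) => //; rewrite ?inE ?eqxx ?orbT // => w w' rw _ wX _ tw_i _.
  by case/existsP: ni; exists w; rewrite /at_slot rw wX tw_i eqxx.
have [/existsP[wj /and3P[rj jX /eqP tj]]|nj] := boolP [exists w, at_slot j w]; last first.
  apply: (opt j i b) => //; rewrite ?inE ?eqxx ?orbT //.
    by move: uijl; rewrite /= !inE (eq_sym i j) !negb_or !andbT => /andP[/andP[-> ->] ->].
  move=> w w' rw _ wX _ tw_i _.
  by case/existsP: nj; exists w; rewrite /at_slot rw wX tw_i eqxx.
have [/existsP[wl /and3P[rl lX /eqP tl]]|nl] := boolP [exists w, at_slot l w]; last first.
  apply: (opt i j b) => //; rewrite ?inE ?eqxx ?orbT // => w w' _ rw _ wX _ tw_i.
  by case/existsP: nl; exists w'; rewrite /at_slot rw wX tw_i eqxx.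
have [uij uil ujl] : [/\ i != j, i != l & j != l].
  by move: uijl; rewrite /= !inE negb_or andbT => /andP[/andP[]].
have neq s s' w w' : t w = s -> t w' = s' -> s != s' -> w != w'.
  by move=> <- <-; apply: contra_neq => ->.
have [ac ec] : a <> c /\ e <> c by move: pli; rewrite /c; case: (a) (e) => [[]|] [[]|].
have [||||||b' tw' [eb|eb]] := @align_bits X h b c r wi wj wl tw rX ri rj rl.
- exact: neq uij.
- exact: neq uil.
- exact: neq ujl.
- by rewrite hp // ti.
- by rewrite hp // tj -pij.
- by rewrite hp // tl.
- apply: (opt i j b') => //; rewrite ?inE ?eqxx ?orbT // => w w' rw rw' _ _ ew ew'.
  have -> : w = wi by apply: tinj; rewrite // ti.
  by have -> : w' = wl by apply: tinj; rewrite // tl.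
- apply: (opt j i b') => //; rewrite ?inE ?eqxx ?orbT //.
    by rewrite /= !inE negb_or (eq_sym j) uij uil ujl.
  move=> w w' rw rw' _ _ ew ew'.
  have -> : w = wj by apply: tinj; rewrite // tj.
  by have -> : w' = wl by apply: tinj; rewrite // tl.
Qed.

Lemma twisted_sub X (Y : {set G}) h b : Y \subset X -> twisted X h b -> twisted Y h b.
Proof.
move=> /subsetP YX [inj ok]; split=> [v /YX|v w /YX vX /YX]; first exact: inj.
exact: ok.
Qed.

Lemma twisted_add_or_stuck X h b r : twisted X h b -> r \notin X ->
  (exists h' b', twisted (r |: X) h' b') \/
  [/\ forall w, adj r w -> w \in X, 2 < #|[set w | adj r w]| &
      forall w w', adj r w -> adj r w' -> h w r = h w' r].
Proof.
move=> tw rX; have add : (exists2 a, adj r a & a \notin X) \/ #|[set w | adj r w]| < 3 \/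
    (exists w w', [/\ adj r w, adj r w', w \in X, w' \in X & h w r <> h w' r]) ->
    exists h' b', twisted (r |: X) h' b'.
  by case/(twisted_add tw rX) => h' [b' [tw' _]]; exists h', b'.
have [/existsP[w /andP[rw wX]]|/existsPn NX] := boolP [exists w, adj r w && (w \notin X)].
  by left; apply: add; left; exists w.
have {}NX w : adj r w -> w \in X by have := NX w; case: (adj r w) => //=; rewrite negbK.
have [lt3|ge3] := ltnP #|[set w | adj r w]| 3.
  by left; apply: add; right; left.
have [/existsP[w /existsP[w' /and3P[rw rw' /eqP ww']]]|/existsPn Na] :=
    boolP [exists w, exists w', [&& adj r w, adj r w' & h w r != h w' r]].
  by left; apply: add; right; right; exists w, w'; split=> //; exact: NX.
right; split=> // w w' rw rw'; apply/eqP/negPn/negP => ne.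
by have /existsPn/(_ w') := Na w; rewrite rw rw' ne.
Qed.

(* If all labels pendant at [r] equal [a], moving the hole from [r] to a
   neighbor [x] labels the half-edge from [r] to [x] by [a].  So, as the hole
   moves along the path, the labels pendant at it can only be constant if they
   are all equal to [a], which fails at the end of the path at the latest. *)
Lemma hole_walk p X h b r a u y : twisted X h b -> r \notin X ->
  path (@adj G) r (rcons p y) -> uniq (r :: rcons p y) ->
  {subset rcons p y <= X} -> adj r u -> u \in X -> h u r = a ->
  h y (last r p) <> a ->
  exists h' b', twisted (r |: X) h' b'.
Proof.
elim: p X h b r u => [|x p IH] X h b r u tw rX.
  rewrite /= andbT => ry _ sub ru uX hu hy.
  have [|h' [b' [tw' _]]] := @twisted_add X h b r tw rX; last by exists h', b'.
  right; right; exists u, y; split=> //; first by rewrite sub ?inE.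
  by rewrite hu => /esym.
rewrite rcons_cons /= => /andP[rx px] /andP[rnot ux] sub ru uX hu hy.
have [//|[NX ge3 Neq]] := twisted_add_or_stuck tw rX.
have Na w : adj r w -> h w r = a by move=> rw; rewrite -hu; exact: Neq.
have xX : x \in X by exact: NX.
have tw1 : twisted (X :\ x) h b by apply: twisted_sub tw; exact: subsetDl.
have rX1 : r \notin X :\ x by rewrite !inE (negPf rX) andbF.
have [|h1 [b1 [tw2 h1X]]] := @twisted_add _ _ _ _ tw1 rX1.
  by left; exists x; rewrite // !inE eqxx.
have h1r w : adj r w -> w != x -> h1 r w <> a.
  move=> rw wx; have wX1 : w \in X :\ x by rewrite !inE wx NX.
  by have [] := tw2.2 r w (setU11 _ _) (setU1r _ wX1) rw; rewrite (h1X w) // (Na w).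
(* The three labels at [r] are distinct, and the two not towards [x] avoid [a]. *)
have h1x : h1 r x = a.
  have [w1 [w2 [r1 r2 n12 n1x n2x]]] : exists w1 w2, [/\ adj r w1, adj r w2, w1 != w2, w1 != x & w2 != x].
    have : 1 < #|[set w | adj r w] :\ x| by move: ge3; rewrite (cardsD1 x) inE rx.
    case/card_gt1P => w1 [w2 []]; rewrite !inE => /andP[? ?] /andP[? ?] ?.
    by exists w1, w2.
  have linj := tw2.1 r (setU11 _ _).
  have e12 : h1 r w1 <> h1 r w2 by move/linj => e; rewrite e ?eqxx in n12.
  have e1x : h1 r w1 <> h1 r x by move/linj => e; rewrite e ?eqxx in n1x.
  have e2x : h1 r w2 <> h1 r x by move/linj => e; rewrite e ?eqxx in n2x.
  move: (h1r w1 r1 n1x) (h1r w2 r2 n2x) e12 e1x e2x.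
  by case: (a) (h1 r x) (h1 r w1) (h1 r w2) => [[]|] [[]|] [[]|] [[]|].
have yX1 : y \in X :\ x.
  rewrite !inE sub ?andbT; last by rewrite inE mem_rcons mem_head orbT.
  by move: ux; rewrite mem_rcons inE negb_or => /andP[/andP[]]; rewrite eq_sym.
have [||||||h' [b' tw']] := IH (r |: (X :\ x)) h1 b1 x r tw2 _ px ux.
- by rewrite !inE eqxx orbF eq_sym; apply: contraNneq rX => ->.
- move=> w wp; rewrite !inE sub ?inE ?wp ?orbT // andbT.
  by apply/orP; right; case/andP: ux => + _; apply: contraNneq => <-.
- by rewrite adj_sym.
- by rewrite !inE eqxx.
- by [].
- by rewrite h1X.
exists h', b'; suff <- : x |: (r |: X :\ x) = r |: X by [].
by rewrite setUCA setD1K.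
Qed.

Lemma third_lrot x y : x <> y -> third (lrot x) (lrot y) = lrot (third x y).
Proof. by case: x y => [[]|] [[]|]. Qed.

Lemma lrotK x : lrot (lrot (lrot x)) = x.
Proof. by case: x => [[]|]. Qed.

(** Rotation permutes the letters and commutes with [third]; the bits are permuted along, [lrot]
    applied twice being the inverse rotation. *)
Lemma twisted_lrot X h b (C : pred G) : twisted X h b ->
  (forall v w, v \in X -> w \in X -> adj v w -> C v = C w) ->
  twisted X (fun v w => if C v then lrot (h v w) else h v w)
    (fun v c => if C v then b v (lrot (lrot c)) else b v c).
Proof.
move=> [inj ok] closed; split=> [v vX w w' vw vw'|v w vX wX vw].
  case: ifP => _; last exact: inj.
  by move/(congr1 (lrot \o lrot)); rewrite /= !lrotK; apply: inj.
have [e1 e2] := ok v w vX wX vw; rewrite (closed v w) //; case: (C w) => //.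
rewrite third_lrot // lrotK; split=> // /(congr1 (lrot \o lrot)).
by rewrite /= !lrotK.
Qed.

(** If [r] is stuck and two of its neighbors are connected inside [X], the hole is moved along the
    resulting cycle; at its last vertex [y] the half-edges towards [r] and towards the predecessor
    have distinct labels, as [hole_walk] requires. If they are not connected, rotating the letters
    on one component makes the pendant labels differ. *)
Lemma twisted_addT X h b r : twisted X h b -> r \notin X ->
  exists h' b', twisted (r |: X) h' b'.
Proof.
move=> tw rX; have [//|[NX ge3 Neq]] := twisted_add_or_stuck tw rX.
have [u1 [u2 [r1 r2 u12]]] : exists u1 u2, [/\ adj r u1, adj r u2 & u1 != u2].
  have /card_gt1P[u1 [u2 [+ + u12]]] := ltnW ge3.
  by rewrite !inE => r1 r2; exists u1, u2.
pose e v w := [&& adj v w, v \in X & w \in X].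
have e_sym : symmetric e by move=> v w; rewrite /e adj_sym [(v \in X) && _]andbC.
have eX v q : v \in X -> path e v q -> path (@adj G) v q /\ {subset v :: q <= X}.
  elim: q v => [|w q IH] v vX /=; first by split=> // w; rewrite inE => /eqP ->.
  case/andP=> /and3P[vw _ wX] /(IH _ wX)[-> sub]; rewrite vw; split=> // x.
  by rewrite inE => /orP[/eqP -> //|]; apply: sub.
have [/connectP[q0 pq0 lq0]|nconn] := boolP (connect e u1 u2).
  case/shortenP: pq0 lq0 => q pq uq _; have [aq sub] := eX _ _ (NX _ r1) pq.
  case/lastP: q pq uq aq sub => [|q y] pq uq aq sub; first by move=> e12; rewrite e12 eqxx in u12.
  rewrite last_rcons => ey; rewrite {}ey {u2 u12} in r2.
  apply: (@hole_walk (u1 :: q) X h b r (h u1 r) u1 y) => //; last 1 first.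
  - have yX : y \in X by exact: NX.
    have lX : last u1 q \in X by rewrite sub // -rcons_cons mem_rcons inE mem_last orbT.
    move: aq; rewrite rcons_path adj_sym => /andP[_ yl].
    have yr : adj y r by rewrite adj_sym.
    rewrite (Neq u1 y) // => hh; have e' := tw.1 y yX _ _ yl yr hh.
    by rewrite e' (negPf rX) in lX.
  - by rewrite rcons_cons /= r1.
  - rewrite rcons_cons cons_uniq uq andbT; apply: contraNN rX; exact: sub.
  - exact: NX.
pose C v := connect e u1 v.
have closed v w : v \in X -> w \in X -> adj v w -> C v = C w.
  move=> vX wX vw; apply: same_connect_r; first exact: sym_connect_sym.
  by apply: connect1; rewrite /e vw vX.
have [//|[_ _ Neq']] := twisted_add_or_stuck (twisted_lrot tw closed) rX.
move: (Neq' u1 u2 r1 r2); rewrite /C connect0 (negPf nconn) (Neq u1 u2) //.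
by move/lrot_neq.
Qed.

Lemma twisted_exists : exists h b, twisted setT h b.
Proof.
suff IH m X h b : #|~: X| <= m -> twisted X h b -> exists h b, twisted setT h b.
  apply: (IH _ set0 (fun _ _ => None) (fun _ _ => true) (leqnn _)).
  by split=> v; rewrite inE.
elim: m X h b => [|m IH] X h b leX tw.
  move: leX; rewrite leqn0 cards_eq0 => /eqP X0.
  by exists h, b; rewrite -(setCK X) X0 setC0 in tw.
have [X0|/set0Pn[r]] := eqVneq (~: X) set0.
  by exists h, b; rewrite -(setCK X) X0 setC0 in tw.
rewrite inE => rX; have [h' [b' tw']] := twisted_addT tw rX.
apply: IH tw'; rewrite setCU setIC -setDE -ltnS; apply: leq_trans leX.
by rewrite [in leqRHS](cardsD1 r) inE rX.
Qed.

End TwistedLabelling.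

(** * Bipartite edge colorings *)

Lemma free_letter (T : finType) (A : {set T}) (g : T -> letter) :
  #|A| < 3 -> exists a, {in A, forall x, g x != a}.
Proof.
move=> A2; have : #|g @: A| < #|{: letter}|.
  by rewrite card_option card_bool; apply: leq_ltn_trans A2; exact: leq_imset_card.
rewrite ltnNge => /negP nsub.
have [a aA] : exists a, a \notin g @: A.
  apply/existsP; rewrite -negb_forall; apply/negP => /forallP full; apply: nsub.
  by rewrite -cardsT subset_leq_card //; apply/subsetP => a _; exact: full.
by exists a => x xA; apply: contraNneq aA => <-; exact: imset_f.
Qed.

Lemma extend_letters (T : finType) (N D : {set T}) (g : T -> letter) :
  #|N| <= 3 -> D \subset N -> {in D &, injective g} ->
  exists2 g', {in D, g' =1 g} & {in N &, injective g'}.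
Proof.
move=> N3; have [m] := ubnP #|N :\: D|; elim: m D g => // m IH D g lt DN inj.
have [/eqP|/set0Pn[x]] := eqVneq (N :\: D) set0.
  rewrite setD_eq0 => ND; exists g => // x y xN yN.
  by apply: inj; exact: (subsetP ND).
rewrite inE => /andP[xD xN].
have [|a aD] := @free_letter T D g.
  apply: leq_trans N3; apply: proper_card; rewrite properE DN.
  by apply/subsetPn; exists x.
pose g1 y := if y == x then a else g y.
have g1D y : y \in D -> g1 y = g y.
  by move=> yD; rewrite /g1; case: eqP => // yx; rewrite -yx yD in xD.
have [|||g' g'1 g'inj] := IH (x |: D) g1.
- rewrite -ltnS; apply: leq_trans lt; rewrite ltnS [leqRHS](cardsD1 x) inE xD xN ltnS.
  by apply/subset_leq_card/subsetP => y; rewrite !inE negb_or => /andP[/andP[-> ->] ->].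
- by rewrite subUset sub1set xN.
- move=> y z /setU1P[->|yD] /setU1P[->|zD] //.
  + by rewrite (g1D z) // /g1 eqxx => e; have := aD z zD; rewrite -e eqxx.
  + by rewrite (g1D y) // /g1 eqxx => e; have := aD y yD; rewrite e eqxx.
  + by rewrite !g1D //; exact: inj.
by exists g' => // y yD; rewrite g'1 ?g1D // inE yD orbT.
Qed.

Lemma connect_last (T : finType) (e : rel T) x y : connect e x y -> x != y ->
  exists2 z, connect e x z & e z y.
Proof.
case/connectP=> p; case/lastP: p => [_ ->|p w]; first by rewrite eqxx.
rewrite rcons_path last_rcons => /andP[xp pw] -> _.
by exists (last x p) => //; apply/connectP; exists p.
Qed.

Section Konig.
Variable T : finType.
Implicit Types (P : {set T * T}) (f : T -> T -> letter).

(** [P] is a bipartite graph whose sides are two copies of [T], one for each coordinate. *)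
Definition proper_edges P f :=
  (forall u w w', (u, w) \in P -> (u, w') \in P -> f u w = f u w' -> w = w') /\
  (forall u u' w, (u, w) \in P -> (u', w) \in P -> f u w = f u' w -> u = u').

Lemma proper_edges_add P f u w a : proper_edges P f ->
  (forall w', (u, w') \in P -> f u w' != a) ->
  (forall u', (u', w) \in P -> f u' w != a) ->
  exists f', proper_edges ((u, w) |: P) f'.
Proof.
move=> [row col] fu fw.
exists (fun x y => if (x, y) == (u, w) then a else f x y).
split=> [x y y'|x x' y]; rewrite !inE.
  case: eqP => [[e1 e2] _|_ /= xy]; case: eqP => [[e3 e4] _|_ /= xy'].
  - by rewrite e2 e4.
  - by rewrite e1 in xy' * => e; have := fu y' xy'; rewrite -e eqxx.
  - by rewrite e3 in xy * => e; have := fu y xy; rewrite e eqxx.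
  - exact: row.
case: eqP => [[e1 e2] _|_ /= xy]; case: eqP => [[e3 e4] _|_ /= xy'].
- by rewrite e1 e3.
- by rewrite e2 in xy' * => e; have := fw x' xy'; rewrite -e eqxx.
- by rewrite e4 in xy * => e; have := fw x xy; rewrite e eqxx.
- exact: col.
Qed.

Definition swap (a b c : letter) := if c == a then b else if c == b then a else c.

Lemma swap_inj a b : injective (swap a b).
Proof. by case: a b => [[]|] [[]|] [[]|] [[]|]. Qed.

(* Kempe chain: the [a]-[b]-chain starting at the column [w], where [b] is
   missing, cannot reach the row [u], where [a] is missing. *)
Lemma kempe P f u w a b : proper_edges P f -> a != b ->
  (forall w', (u, w') \in P -> f u w' != a) ->
  (forall u', (u', w) \in P -> f u' w != b) ->
  exists2 f', proper_edges P f' &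
    (forall w', (u, w') \in P -> f' u w' != a) /\
    (forall u', (u', w) \in P -> f' u' w != a).
Proof.
move=> [row col] ab fu fw.
(* Only the columns of the chain are recorded. One direction is enough, since the chain leaves [w]
   by an [a]-edge. *)
pose step s s' := [exists x, [&& (x, s) \in P, f x s == a, (x, s') \in P & f x s' == b]].
pose K := connect step w.
have back x s : (x, s) \in P -> K s -> f x s = b ->
    exists s0, [/\ K s0, (x, s0) \in P & f x s0 = a].
  move=> xs Ks fb; have ws : w != s.
    by apply/eqP => e; rewrite -e in xs fb; have := fw x xs; rewrite fb eqxx.
  have [s0 K0 /existsP[y /and4P[ys0 /eqP ya ys /eqP yb]]] := connect_last Ks ws.
  by rewrite (col x y s xs ys) ?fb ?yb //; exists s0.
have forth x s s' : (x, s) \in P -> (x, s') \in P -> K s -> f x s = a ->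
    f x s' = b -> K s'.
  move=> xs xs' Ks fa fb; apply: connect_trans Ks (connect1 _).
  by apply/existsP; exists x; rewrite xs xs' fa fb !eqxx.
have mixed x s s' : (x, s) \in P -> (x, s') \in P -> K s -> ~~ K s' ->
    swap a b (f x s) = f x s' -> s = s'.
  move=> xs xs' Ks Ks'; rewrite /swap; case: eqP => [fa|_].
    by move/esym=> fb; rewrite (forth x s s') in Ks'.
  case: eqP => [fb|_]; last exact: row.
  have [s0 [K0 xs0 fa0]] := back x s xs Ks fb.
  by rewrite -fa0 => /(row x s0 s' xs0 xs') e; rewrite -e K0 in Ks'.
exists (fun x s => if K s then swap a b (f x s) else f x s); first split.
- move=> x s s' xs xs'; case: (boolP (K s)) => Ks; case: (boolP (K s')) => Ks'.
  + by move/swap_inj; exact: row.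
  + exact: mixed.
  + by move/esym/mixed => e; symmetry; exact: e.
  + exact: row.
- by move=> x x' s xs xs'; case: ifP => _; [move/swap_inj|]; exact: col.
split=> [s us|x xw].
  case: ifP => Ks; last exact: fu.
  rewrite /swap (negPf (fu s us)); case: (f u s =P b) => [fb|_]; last exact: fu.
  by have [s0 [_ us0 fa]] := back u s us Ks fb; have := fu s0 us0; rewrite fa eqxx.
rewrite /K connect0 /swap (negPf (fw x xw)).
by case: (f x w =P a) => [_|/eqP]; first rewrite eq_sym.
Qed.

(** One edge is removed and the rest colored by induction. Each end of this edge then misses a
    letter, and [kempe] makes the two missing letters coincide. *)
Lemma konig3 P : (forall u, #|[set w | (u, w) \in P]| <= 3) ->
  (forall w, #|[set u | (u, w) \in P]| <= 3) -> exists f, proper_edges P f.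
Proof.
have [m] := ubnP #|P|; elim: m P => // m IH P ltm rows cols.
have [->|/set0Pn[[u w] uw]] := eqVneq P set0.
  by exists (fun _ _ => None); split=> x y z; rewrite inE.
pose P1 := P :\ (u, w).
have sub x y : (x, y) \in P1 -> (x, y) \in P by rewrite inE => /andP[].
have [|x|x|f pf] := IH P1.
- by move: ltm; rewrite (cardsD1 (u, w)) uw.
- by apply: leq_trans (rows x); apply/subset_leq_card/subsetP => y; rewrite !inE => /andP[].
- by apply: leq_trans (cols x); apply/subset_leq_card/subsetP => y; rewrite !inE => /andP[].
have [|a fa] := @free_letter _ [set y | (u, y) \in P1] (f u).
  apply: leq_trans (rows u); rewrite [leqRHS](cardsD1 w) inE uw ltnS.
  by apply/subset_leq_card/subsetP => y; rewrite !inE xpair_eqE eqxx.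
have [|b fb] := @free_letter _ [set x | (x, w) \in P1] (f^~ w).
  apply: leq_trans (cols w); rewrite [leqRHS](cardsD1 u) inE uw ltnS.
  by apply/subset_leq_card/subsetP => y; rewrite !inE xpair_eqE eqxx andbT.
have {}fa y : (u, y) \in P1 -> f u y != a by move=> uy; apply: fa; rewrite inE.
have {}fb x : (x, w) \in P1 -> f x w != b by move=> xw; apply: fb; rewrite inE.
rewrite -(setD1K uw); have [e|ab] := eqVneq a b.
  by apply: proper_edges_add pf fa _; rewrite e.
by have [f' pf' [fa' fb']] := kempe pf ab fa fb; exact: proper_edges_add pf' fa' fb'.
Qed.

End Konig.

(** * Labels from a maximal bipartite subgraph *)

Section Bipartition.
Variable G : sgraph.
Hypothesis deg3 : forall v : G, #|[set w | adj v w]| <= 3.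
Implicit Types (t : {ffun G -> option bool}) (Q : {set G}).

(** The independent sets are the preimages of [Some false] and [Some true]; [None] marks the
    uncovered vertices. *)
Definition two_sided t := [forall v, forall w, adj v w ==> (t v == None) || (t v != t w)].

Lemma two_sidedP t : reflect (forall v w, adj v w -> t v <> None -> t v <> t w) (two_sided t).
Proof.
apply: (iffP idP) => [/forallP ts v w vw n|ts]; last apply/forallP => v.
  by have /forallP/(_ w)/implyP/(_ vw)/orP[/eqP //|/eqP //] := ts v.
by apply/forallP => w; apply/implyP => vw; case: eqP => //= n; apply/eqP; exact: ts.
Qed.

Definition covered t := [set v | t v != None].

Lemma max_two_sided : exists2 t, two_sided t &
  forall t', two_sided t' -> #|covered t'| <= #|covered t|.
Proof.
have ts0 : two_sided [ffun _ => None].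
  by apply/two_sidedP => v w _; rewrite ffunE.
by case: (arg_maxnP (fun t => #|covered t|) ts0) => t ts tmax; exists t.
Qed.

Definition update t v c : {ffun G -> option bool} := [ffun w => if w == v then Some c else t w].

Lemma update_two_sided t v c : two_sided t ->
  (forall w, adj v w -> t w <> Some c) -> two_sided (update t v c).
Proof.
move=> /two_sidedP ts free; apply/two_sidedP => x y xy; rewrite !ffunE.
case: eqP => [ex|_]; case: eqP => [ey|_].
- by rewrite ex ey adj_irrefl in xy.
- by rewrite ex in xy => _ /esym; exact: free.
- by rewrite ey adj_sym in xy => _; exact: free.
- exact: ts.
Qed.

Lemma covered_update t v c : covered (update t v c) = v |: covered t.
Proof. by apply/setP => w; rewrite !inE ffunE; case: (w =P v). Qed.

Section Maximal.
Variable t : {ffun G -> option bool}.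
Hypothesis ts : two_sided t.
Hypothesis tmax : forall t', two_sided t' -> #|covered t'| <= #|covered t|.

(** Otherwise [f] could join side [c], against maximality. *)
Lemma free_nbr f c : t f = None -> exists2 s, adj f s & t s = Some c.
Proof.
move=> tf; have [/existsP[s /andP[fs /eqP ts']]|/existsPn ns] :=
  boolP [exists s, adj f s && (t s == Some c)]; first by exists s.
have /tmax : two_sided (update t f c).
  by apply: update_two_sided => // w fw; apply/eqP; have := ns w; rewrite fw.
by rewrite covered_update cardsU1 inE tf /= ltnn.
Qed.

(* Otherwise [s] could change side, which makes room for [f]. *)
Lemma unique_nbr_covered f s c : t f = None -> adj f s -> t s = Some c ->
  (forall s', adj f s' -> t s' = Some c -> s' = s) ->
  exists2 s', adj s s' & t s' = Some (~~ c).
Proof.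
move=> tf fs tsc uniq_s.
have [/existsP[s' /andP[ss' /eqP ts']]|/existsPn ns] :=
  boolP [exists s', adj s s' && (t s' == Some (~~ c))]; first by exists s'.
have ts1 : two_sided (update t s (~~ c)).
  by apply: update_two_sided => // w sw; apply/eqP; have := ns w; rewrite sw.
have /tmax : two_sided (update (update t s (~~ c)) f c).
  apply: update_two_sided => // w fw; rewrite ffunE; case: eqP => [_ []|nws tw].
    by case: (c).
  exact/nws/uniq_s.
rewrite !covered_update !cardsU1 !inE tf tsc /= orbF.
suff -> : f == s = false by rewrite ltnn.
by apply/eqP => e; rewrite e adj_irrefl in fs.
Qed.

Definition side_nbr f c := if [pick s | adj f s && (t s == Some c)] is Some s then s else f.

Lemma side_nbrP f c : t f = None -> adj f (side_nbr f c) /\ t (side_nbr f c) = Some c.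
Proof.
move=> tf; rewrite /side_nbr; case: pickP => [s /andP[-> /eqP ->] //|no].
by have [s fs tsc] := free_nbr c tf; have := no s; rewrite fs tsc eqxx.
Qed.

(** With [f'] and one neighbor on each side, the three neighbors of [f] are exhausted. *)
Lemma pair_nbrs f f' w : t f = None -> t f' = None -> adj f f' -> adj f w ->
  w = f' \/ exists2 c, t w = Some c & w = side_nbr f c.
Proof.
move=> tf tf' ff' fw.
have [f0 t0] := side_nbrP false tf; have [f1 t1] := side_nbrP true tf.
have [->|n1] := eqVneq w f'; first by left.
right; have [->|n2] := eqVneq w (side_nbr f false); first by exists false.
have [->|n3] := eqVneq w (side_nbr f true); first by exists true.
have := deg3 f; have : w |: (f' |: (side_nbr f false |: [set side_nbr f true])) \subset [set w | adj f w].
  by rewrite !subUset !sub1set !inE fw ff' f0 f1.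
move/subset_leq_card => le1 le2; have {le1 le2} := leq_trans le1 le2.
have m1 : f' != side_nbr f false by apply: contra_eq_neq tf' => ->; rewrite t0.
have m2 : f' != side_nbr f true by apply: contra_eq_neq tf' => ->; rewrite t1.
have m3 : side_nbr f false != side_nbr f true by apply: contra_eq_neq t0 => ->; rewrite t1.
by rewrite !cardsU1 !inE !negb_or n1 n2 n3 m1 m2 m3 cards1.
Qed.

Lemma side_nbr_unique f f' c s : t f = None -> t f' = None -> adj f f' ->
  adj f s -> t s = Some c -> s = side_nbr f c.
Proof.
move=> tf tf' ff' fs tsc; case: (pair_nbrs tf tf' ff' fs) => [e|[c' tc' ->]].
  by rewrite e tf' in tsc.
by move: tc'; rewrite tsc => -[->].
Qed.

(** By [unique_nbr_covered], [side_nbr f c] has a covered neighbor besides [f], which leaves room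
    for one more neighbor. *)
Lemma side_nbr_other f f' c g g' : t f = None -> t f' = None -> adj f f' ->
  t g = None -> t g' = None -> g != f -> g' != f ->
  adj g (side_nbr f c) -> adj g' (side_nbr f c) -> g = g'.
Proof.
move=> tf tf' ff' tg tg' gf g'f ga g'a; have [fa tc] := side_nbrP c tf.
have [|s' as' ts'] := unique_nbr_covered tf fa tc.
  by move=> s' fs'; exact: side_nbr_unique ff' fs'.
apply/eqP/negPn/negP => gg'.
have ns' x : t x = None -> x != s' by move=> tx; apply: contra_eq_neq ts' => <-; rewrite tx.
have := deg3 (side_nbr f c).
have : g |: (g' |: (f |: [set s'])) \subset [set w | adj (side_nbr f c) w].
  by rewrite !subUset !sub1set !inE as' ![adj (side_nbr f c) _]adj_sym ga g'a fa.
move/subset_leq_card => le1 le2; have {le1 le2} := leq_trans le1 le2.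
by rewrite !cardsU1 !inE !negb_or gg' gf g'f !ns' // cards1.
Qed.

(* [k f s] labels the edge between the uncovered [f] and the covered [s]. *)
Definition partial_labels Q (k : G -> G -> letter) (b : G -> letter -> bool) :=
  [/\ forall f s s', f \in Q -> adj f s -> adj f s' -> t s <> None -> t s' <> None ->
        k f s = k f s' -> s = s',
      forall f g s, f \in Q -> g \in Q -> adj f s -> adj g s -> t s <> None ->
        k f s = k g s -> f = g,
      forall f s, f \in Q -> adj f s -> t s <> Some (b f (k f s)) &
      forall f g, f \in Q -> g \in Q -> adj f g -> forall c, b f c <> b g c].

Lemma partial_labels_lonely : exists k b,
  partial_labels [set f | (t f == None) && [forall g, adj f g ==> (t g != None)]] k b.
Proof.
set Q := [set f | _].
pose P := [set e : G * G | [&& e.1 \in Q, adj e.1 e.2 & t e.2 != None]].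
have PE f s : ((f, s) \in P) = [&& f \in Q, adj f s & t s != None] by rewrite inE.
have [u|w|k [row col]] := @konig3 G P.
- by apply: leq_trans (deg3 u); apply/subset_leq_card/subsetP => w; rewrite inE PE inE => /and3P[].
- apply: leq_trans (deg3 w); apply/subset_leq_card/subsetP => u; rewrite inE PE inE => /and3P[].
  by rewrite adj_sym.
(* The bit is opposite to the side reached by the edge labelled [c]. The last condition is vacuous,
   as these vertices have no uncovered neighbor. *)
exists k, (fun f c => [exists s, [&& adj f s, t s == Some false & k f s == c]]).
split=> [f s s' fQ fs fs' /eqP n /eqP n'|f g s fQ gQ fs gs /eqP n|f s fQ fs|f g fQ gQ fg].
- by apply: row; rewrite PE fQ ?fs ?fs'.
- by apply: col; rewrite PE ?fQ ?gQ ?fs ?gs.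
- move=> ts'; move: (ts'); case: existsP => [[s' /and3P[fs' /eqP t' /eqP e]] tt|n tf].
    have es : s' = s by apply: (row f) e; rewrite PE fQ ?fs ?fs' ?t' ?tt.
    by rewrite -es t' in tt.
  by apply: n; exists s; rewrite fs tf !eqxx.
- move: fQ gQ; rewrite !inE => /andP[_ /forallP/(_ g)/implyP/(_ fg) ng] /andP[tg _].
  by rewrite tg in ng.
Qed.

(** List coloring of the 4-cycle [x0], [x1], [y1], [y0] from lists of at least two letters. *)
Lemma pair_letters (p0 p1 q0 q1 : letter) : exists x0 x1 y0 y1,
  [&& x0 != x1, y0 != y1, x0 != y0, x1 != y1 & [&& x0 != p0, x1 != p1, y0 != q0 & y1 != q1]].
Proof.
pose L : seq letter := [:: None; Some false; Some true].
pose test x0 x1 y0 y1 :=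
  [&& x0 != x1, y0 != y1, x0 != y0, x1 != y1 & [&& x0 != p0, x1 != p1, y0 != q0 & y1 != q1]].
have : has (fun x0 => has (fun x1 => has (fun y0 => has (test x0 x1 y0) L) L) L) L.
  by rewrite /test; case: p0 p1 q0 q1 {test} => [[]|] [[]|] [[]|] [[]|].
by case/hasP=> x0 _ /hasP[x1 _ /hasP[y0 _ /hasP[y1 _ ok]]]; exists x0, x1, y0, y1.
Qed.

(** By [side_nbr_other], each edge from [f] or [f'] to a covered vertex has at most one forbidden
    letter, [forb]. Edges from [f] and [f'] to the same side need different letters, because [f] and
    [f'] have opposite bits. *)
Lemma partial_labels_pair Q k b f f' : {in Q, forall g, t g = None} ->
  {in Q, forall g g', adj g g' -> t g' = None -> g' \in Q} ->
  t f = None -> t f' = None -> adj f f' -> f \notin Q -> f' \notin Q ->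
  partial_labels Q k b -> exists k' b', partial_labels (f |: (f' |: Q)) k' b'.
Proof.
move=> tQ closed tf tf' ff' fQ f'Q [row col bit opp].
have f'f : adj f' f by rewrite adj_sym.
pose forb g c := if [pick g' in Q | adj g' (side_nbr g c)] is Some g'
  then k g' (side_nbr g c) else None.
have forbE g c g2 : t g = None -> (exists2 g1, t g1 = None & adj g g1) -> g \notin Q ->
    g2 \in Q -> adj g2 (side_nbr g c) -> k g2 (side_nbr g c) = forb g c.
  move=> tg [g1 tg1 gg1] gQ g2Q a2; rewrite /forb; case: pickP => [g3 /andP[g3Q a3]|/(_ g2)].
    congr (k _ _); apply: (side_nbr_other tg tg1 gg1 _ _ _ _ a2 a3); try exact: tQ.
    - by apply: contraNneq gQ => <-.
    - by apply: contraNneq gQ => <-.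
  by rewrite g2Q a2.
have [x0 [x1 [y0 [y1]]]] := pair_letters (forb f false) (forb f true) (forb f' false) (forb f' true).
case/and5P=> x01 y01 xy0 xy1 /and4P[xp0 xp1 yq0 yq1].
have nff' : f' != f by apply: contraTneq ff' => ->; rewrite adj_irrefl.
pose lx (c : bool) := if c then x1 else x0; pose ly (c : bool) := if c then y1 else y0.
pose k' g s := if g == f then lx (t s == Some true)
  else if g == f' then ly (t s == Some true) else k g s.
(* At [f] the bit must be true for [x0] and false for [x1]; at [f'], whose bits are negated, true
   for [y0] and false for [y1]. *)
pose bf c := (c != x1) && (c != y0).
pose b' g := if g == f then bf else if g == f' then (fun c => ~~ bf c) else b g.
have kQ g s : g \in Q -> k' g s = k g s.
  by move=> gQ; rewrite /k' !ifF //; apply: contraTF gQ => /eqP ->.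
have bQ g : g \in Q -> b' g = b g.
  by move=> gQ; rewrite /b' !ifF //; apply: contraTF gQ => /eqP ->.
have kf s c : t s = Some c -> k' f s = lx c by rewrite /k' eqxx => ->; case: c.
have kf' s c : t s = Some c -> k' f' s = ly c by rewrite /k' (negPf nff') eqxx => ->; case: c.
have lx_inj : injective lx by move=> [] [] //= e; move: x01; rewrite e eqxx.
have ly_inj : injective ly by move=> [] [] //= e; move: y01; rewrite e eqxx.
have lxy c : lx c <> ly c by apply/eqP; case: c.
have lxp c : lx c <> forb f c by apply/eqP; case: c.
have lyq c : ly c <> forb f' c by apply/eqP; case: c.
have someP s : t s <> None -> exists c, t s = Some c by case: (t s) => // c _; exists c.
have uf s c : adj f s -> t s = Some c -> s = side_nbr f c by apply: side_nbr_unique ff'.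
have uf' s c : adj f' s -> t s = Some c -> s = side_nbr f' c by apply: side_nbr_unique f'f.
have fgQ g s c : g \in Q -> adj f s -> adj g s -> t s = Some c -> k' f s <> k' g s.
  move=> gQ fs gs tsc; rewrite (kf s c tsc) kQ // (uf s c fs tsc).
  by rewrite (@forbE f c g) //; [exists f'|rewrite -(uf s c)].
have f'gQ g s c : g \in Q -> adj f' s -> adj g s -> t s = Some c -> k' f' s <> k' g s.
  move=> gQ fs gs tsc; rewrite (kf' s c tsc) kQ // (uf' s c fs tsc).
  by rewrite (@forbE f' c g) //; [exists f|rewrite -(uf' s c)].
have nadjQ g : g \in Q -> ~~ adj g f /\ ~~ adj g f'.
  move=> gQ; split; apply/negP => /(closed g gQ) h; first by rewrite h in fQ.
  by rewrite h in f'Q.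
have b'f : b' f = bf by rewrite /b' eqxx.
have b'f' : b' f' = (fun c => ~~ bf c) by rewrite /b' (negPf nff') eqxx.
exists k', b'; split.
- move=> g s s' gQ gs gs' /someP[c tc] /someP[c' tc'].
  case/setU1P: gQ => [eg|/setU1P[eg|gQ]].
  + rewrite {}eg in gs gs' *; rewrite (kf s c tc) (kf s' c' tc') => /lx_inj e.
    by rewrite (uf s c) // (uf s' c') // e.
  + rewrite {}eg in gs gs' *; rewrite (kf' s c tc) (kf' s' c' tc') => /ly_inj e.
    by rewrite (uf' s c) // (uf' s' c') // e.
  + by rewrite !kQ //; apply: row => //; rewrite ?tc ?tc'.
- move=> g g' s gQ g'Q gs g's /someP[c tc].
  case/setU1P: gQ => [eg|/setU1P[eg|gQ]]; case/setU1P: g'Q => [eg'|/setU1P[eg'|g'Q]];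
    rewrite ?eg ?eg' in gs g's * => //.
  + by rewrite (kf s c tc) (kf' s c tc) => /lxy.
  + by move/(fgQ g' s c g'Q gs g's tc).
  + by rewrite (kf s c tc) (kf' s c tc) => /esym/lxy.
  + by move/(f'gQ g' s c g'Q gs g's tc).
  + by move/esym/(fgQ g s c gQ g's gs tc).
  + by move/esym/(f'gQ g s c gQ g's gs tc).
  + by rewrite !kQ //; apply: col => //; rewrite tc.
- move=> g s gQ gs; case et: (t s) => [c|] //.
  case/setU1P: gQ => [->|/setU1P[->|gQ]].
  + by rewrite (kf s c et) b'f /bf; case: c {et} => /=; rewrite ?eqxx ?x01 ?xy0.
  + rewrite (kf' s c et) b'f' /bf; case: c {et} => /=; last by rewrite eqxx andbF.
    by rewrite eq_sym xy1 eq_sym y01.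
  + by rewrite kQ // bQ // -et; exact: bit.
- move=> g g' gQ g'Q gg' c.
  case/setU1P: gQ => [eg|/setU1P[eg|gQ]]; case/setU1P: g'Q => [eg'|/setU1P[eg'|g'Q]];
    rewrite ?eg ?eg' ?adj_irrefl in gg' * => //; rewrite ?b'f ?b'f'.
  + by case: (bf c).
  + by have [/negP[]] := nadjQ g' g'Q; rewrite adj_sym.
  + by case: (bf c).
  + by have [_ /negP[]] := nadjQ g' g'Q; rewrite adj_sym.
  + by have [/negP[]] := nadjQ g gQ.
  + by have [_ /negP[]] := nadjQ g gQ.
  + by rewrite !bQ //; exact: opp.
Qed.

(** A remaining vertex has exactly one uncovered neighbor, so the set stays closed under uncovered
    neighbors when such a pair is added. *)
Lemma partial_labels_all : exists k b, partial_labels [set f | t f == None] k b.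
Proof.
pose lonely := [set f | (t f == None) && [forall g, adj f g ==> (t g != None)]].
pose F := [set f | t f == None].
suff grow m Q k b : #|F :\: Q| < m -> Q \subset F -> lonely \subset Q ->
    {in Q, forall g g', adj g g' -> t g' = None -> g' \in Q} ->
    partial_labels Q k b -> exists k b, partial_labels F k b.
  have [k [b lab]] := partial_labels_lonely.
  apply: (grow _ _ _ _ (leqnn _)) lab => //.
    by apply/subsetP => f; rewrite !inE => /andP[].
  move=> f; rewrite inE => /andP[_ /forallP fl] g fg tg.
  by have := fl g; rewrite fg tg.
elim: m Q k b => // m IH Q k b ltm /subsetP QF /subsetP lQ closed lab.
have tF g : g \in F -> t g = None by rewrite inE => /eqP.
have [FQ|/set0Pn[f]] := eqVneq (F :\: Q) set0.
  exists k, b; suff -> : F = Q by [].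
  by apply/setP => f; apply/idP/idP => [|/QF //]; apply/subsetP; rewrite -setD_eq0 FQ.
rewrite inE => /andP[fQ fF]; have tf := tF f fF.
have [/existsP[f' /andP[ff' /eqP tf']]|/existsPn nf] := boolP [exists f', adj f f' && (t f' == None)]; last first.
  case/negP: fQ; apply: lQ; rewrite inE tf eqxx; apply/forallP => g.
  by apply/implyP => fg; have := nf g; rewrite fg.
have f'Q : f' \notin Q by apply: contraNN fQ => /closed; apply; rewrite // adj_sym.
have [k' [b' lab']] := partial_labels_pair (fun g gQ => tF g (QF g gQ)) closed tf tf' ff' fQ f'Q lab.
apply: IH lab'.
- rewrite -ltnS; apply: leq_trans ltm; rewrite ltnS [leqRHS](cardsD1 f) inE fQ fF.
  by apply/subset_leq_card/subsetP => g; rewrite !inE !negb_or -!andbA => /and4P[-> _ -> ->].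
- by rewrite !subUset !sub1set fF inE tf' eqxx; apply/subsetP.
- by apply/subsetP => g /lQ gQ; rewrite !inE gQ !orbT.
- have nbr g g' g1 : t g = None -> t g' = None -> adj g g' -> adj g g1 -> t g1 = None -> g1 = g'.
    by move=> tg tg' gg' gg1; case: (pair_nbrs tg tg' gg' gg1) => // -[c -> _].
  move=> g gQ g' gg' tg'; rewrite !inE.
  case/setU1P: gQ => [eg|/setU1P[eg|gQ]].
  + by rewrite eg in gg'; rewrite (nbr f f' g') // eqxx orbT.
  + by rewrite eg in gg'; rewrite (nbr f' f g') ?eqxx // adj_sym.
  + by rewrite (closed g gQ g') ?orbT.
Qed.

End Maximal.

Definition balanced (h : G -> G -> letter) (b : G -> letter -> bool) :=
  forall v w, adj v w ->
    (forall c, b v c <> b w c) \/ (h v w = h w v /\ b v (h v w) <> b w (h v w)).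

Lemma balanced_exists : exists h b, (forall v, locally_inj h v) /\ balanced h b.
Proof.
have [t ts tmax] := max_two_sided.
have [k [b [row col bit opp]]] := partial_labels_all ts tmax.
(* Both half-edges of an edge between a covered and an uncovered vertex get its label [k]; the other
   half-edges at each vertex are filled in greedily. *)
have [h hP] : exists h : G -> G -> letter, forall v, locally_inj h v /\
    (forall w, adj v w -> (t v == None) != (t w == None) ->
      h v w = if t v == None then k v w else k w v).
  apply: (@fin_all_exists G (fun _ => G -> letter) (fun v hv =>
    (forall w w' : G, adj v w -> adj v w' -> hv w = hv w' -> w = w') /\
    (forall w, adj v w -> (t v == None) != (t w == None) ->
      hv w = if t v == None then k v w else k w v))) => v.
  have [|||hv hvD hv_inj] := @extend_letters G [set w | adj v w]
    [set w | adj v w && ((t v == None) != (t w == None))]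
    (fun w => if t v == None then k v w else k w v).
  - exact: deg3.
  - by apply/subsetP => w; rewrite !inE => /andP[].
  - move=> w w'; rewrite !inE; case: (t v =P None) => tv /andP[vw tw] /andP[vw' tw'].
      apply: row; rewrite ?inE ?tv // => e; first by rewrite e in tw.
      by rewrite e in tw'.
    have {}tw : t w = None by case: (t w) tw.
    have {}tw' : t w' = None by case: (t w') tw'.
    by apply: col => //; rewrite ?inE ?tw ?tw' // adj_sym.
  exists hv; split=> [w w' vw vw'|w vw d]; first by apply: hv_inj; rewrite inE.
  by apply: hvD; rewrite inE vw.
exists h, (fun v c => if t v is Some x then x else b v c); split=> [v|v w vw].
  by case: (hP v).
have wv : adj w v by rewrite adj_sym.
have hvw := (hP v).2 w vw; have hwv := (hP w).2 v wv.
have := (two_sidedP _ ts) v w vw.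
move: hvw hwv; case tv: (t v) => [x|]; case tw: (t w) => [y|] /= hvw hwv sides.
- by left=> _ e; apply: sides; rewrite // e.
- rewrite hvw // hwv //; right; split=> //.
  by have := bit w v; rewrite inE tw tv => h' e; apply: h'; rewrite // -e.
- rewrite hvw // hwv //; right; split=> //.
  by have := bit v w; rewrite inE tw tv => h' e; apply: h'; rewrite // e.
- by left; apply: opp; rewrite ?inE ?tv ?tw.
Qed.

End Bipartition.

(** * Colorings from labels *)

Section Schemes.
Variables (G : sgraph) (k : nat).
Implicit Types (v w : G) (F : G -> G -> nat -> letter * nat).

(* The [3 k + 1] colors are the pairs [(c, j)] with [0 < j <= k], and [(None, 0)]. *)
Definition color (x : letter * nat) := (if x.1 is Some _ then 0 < x.2 else true) && (x.2 <= k).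

Definition code (x : letter * nat) :=
  x.2 + (if x.1 is Some b then if b then k.*2 else k else 0).

Lemma code_ltn x : color x -> code x < (3 * k).+1.
Proof. by case: x => [[[]|] j]; rewrite /color /code /=; lia. Qed.

Lemma code_inj x y : color x -> color y -> code x = code y -> x = y.
Proof.
case: x y => [[[]|] i] [[[]|] j]; rewrite /color /code /= => ? ? ?; try lia;
by congr pair; lia.
Qed.

Lemma edge_coloring_code n m F :
  (forall v w i, adj v w -> i <= n -> color (F v w i)) ->
  (forall v w i, adj v w -> i <= n -> F w v i = F v w (n - i)) ->
  (forall v w w', adj v w -> adj v w' -> F v w 0 = F v w' 0) ->
  (forall v w i j, adj v w -> i < j -> j <= n -> j <= i + m -> F v w i <> F v w j) ->
  (forall v w w' i j, adj v w -> adj v w' -> w <> w' -> 0 < i -> 0 < j ->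
        i + j <= m -> F v w i <> F v w' j) ->
  m <= n ->
  exists F' : G -> G -> nat -> nat, @edge_coloring G n (3 * k).+1 m F'.
Proof.
move=> colF symF cenF edgeF vertF mn; exists (fun v w i => code (F v w i)); split.
- move=> v w i vw i_n; split; first exact/code_ltn/colF.
  by rewrite symF.
- by move=> v w w' vw vw'; rewrite (cenF v w w').
- move=> v w i j vw ij jn jim /code_inj e; apply: (edgeF v w i j) => //.
  by apply: e; apply: colF => //; lia.
- move=> v w w' i j vw vw' ww' i0 j0 ij /code_inj e.
  apply: (vertF v w w' i j) => //.
  by apply: e; apply: colF => //; lia.
Qed.

(** * Filling the edges when [d <= k] *)

Section Short.
Variables (d : nat) (h : G -> G -> letter) (b : G -> letter -> bool).
Hypotheses (dk : d <= k) (twG : twisted setT h b).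

(* With [e] set, the order of the [d] last levels is reversed. *)
Definition turn (e : bool) j := if e && (k - d < j) then k.*2.+1 - d - j else j.

Definition short_color v w i :=
  let n := k.*2.+1 + d in
  if i == 0 then (None, 0)
  else if i <= k then (h v w, turn (b v (h v w)) i)
  else if i <= k + d then
    let c := third (h v w) (h w v) in (c, turn (b v c) (k.*2.+1 - i))
  else if i < n then (h w v, turn (b w (h w v)) (n - i))
  else (None, 0).

Lemma turn_bound e j : 0 < j <= k -> 0 < turn e j <= k.
Proof. by rewrite /turn; case: ifP; lia. Qed.

Lemma turn_inj e i j : i <= k -> j <= k -> turn e i = turn e j -> i = j.
Proof. by rewrite /turn; case: e => /=; case: (ltnP (k - d) i); case: (ltnP (k - d) j); lia. Qed.

(** Opposite bits make the inner colors read the same from both ends of the edge. *)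
Lemma turn_neg e e' j : e <> e' -> k - d < j <= k -> turn e j = turn e' (k.*2.+1 - d - j).
Proof. by rewrite /turn; case: e e' => [] [] //= _ /andP[h1 h2]; rewrite ifT; lia. Qed.

(** The level [i] lies below the block of [d] levels that may be reversed, and [j] cannot be sent
    down to it. *)
Lemma turn_near e e' i j : i + d < j -> j <= k -> turn e i <> turn e' j.
Proof.
rewrite /turn; case: e e' => [] [] /=; case: (ltnP (k - d) i); case: (ltnP (k - d) j); lia.
Qed.

Ltac turn_lia := match goal with
  | H : 0 = turn ?e ?j |- _ => have := @turn_bound e j; lia
  | H : turn ?e ?j = 0 |- _ => have := @turn_bound e j; lia
  | H : turn ?e ?i = turn ?e ?j |- _ => have := @turn_inj e i j; lia
  | H : turn ?e ?i = turn ?e' ?j |- _ =>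
      have := @turn_near e e' i j; have := @turn_near e' e j i; lia
  end.

(** The inner vertex at position [i] has level [k.*2.+1 - i], turned by the same bit as the
    half-edge at [v] with that letter, so its color recurs there at distance exactly [2 k + 1].
    Colors from the far half-edge are handled by [turn_near]. *)
Lemma short_edge_coloring : exists F : G -> G -> nat -> nat, @edge_coloring G (k.*2.+1 + d) (3 * k).+1 k.*2 F.
Proof.
have [inj ok] := twG.
have {}inj v : locally_inj h v by apply: inj; rewrite inE.
have {}ok v w : adj v w -> h v w <> h w v /\
    b v (third (h v w) (h w v)) <> b w (third (h v w) (h w v)).
  by move=> vw; apply: ok; rewrite ?inE.
have hC (c : letter) j : 0 < j <= k -> color (c, j) by case: c => [c|]; rewrite /color /=; lia.
pose n := k.*2.+1 + d.
have S v w i : [\/ i = 0 /\ short_color v w i = (None, 0),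
   0 < i <= k /\ short_color v w i = (h v w, turn (b v (h v w)) i),
   k < i <= k + d /\ short_color v w i = (third (h v w) (h w v), turn (b v (third (h v w) (h w v))) (k.*2.+1 - i)) |
   k + d < i < n /\ short_color v w i = (h w v, turn (b w (h w v)) (n - i)) \/
   n <= i /\ short_color v w i = (None, 0)].
  rewrite /short_color; case: eqP => [->|i0]; first by constructor 1.
  case: (leqP i k) => h1; first by constructor 2; split=> //; lia.
  case: (leqP i (k + d)) => h2; first by constructor 3; split=> //; lia.
  by constructor 4; case: (ltnP i (k.*2.+1 + d)) => h3; [left; split=> //; lia|right].
apply: (@edge_coloring_code n k.*2 short_color); last by rewrite /n; lia.
- move=> v w i vw i_n.
  case: (S v w i) => [[_ ->]|[hi ->]|[hi ->]|[[hi ->]|[_ ->]]] //;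
    by apply: hC; apply: turn_bound; lia.
- move=> v w i vw i_n; have [ne bne] := ok v w vw.
  case: (S w v i) => [[hi ->]|[hi ->]|[hi ->]|[[hi ->]|[hi ->]]];
  case: (S v w (n - i)) => [[hj ->]|[hj ->]|[hj ->]|[[hj ->]|[hj ->]]] //; try lia.
  + by rewrite subKn.
  + rewrite (thirdC (h w v)); congr pair; rewrite (turn_neg bne); last by lia.
    by congr turn; lia.
- by [].
- move=> v w i j vw ij j_n jim; have [ne bne] := ok v w vw.
  have [nt1 nt2] := third_neq ne.
  case: (S v w i) => [[hi ->]|[hi ->]|[hi ->]|[[hi ->]|[hi ->]]];
  case: (S v w j) => [[hj ->]|[hj ->]|[hj ->]|[[hj ->]|[hj ->]]] //; try lia;
  move=> e; have /= e1 := congr1 fst e; have /= := congr1 snd e; try rewrite e1; move=> e2;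
  clear e S ok inj hC twG; try congruence; turn_lia.
- move=> v w w' i j vw vw' ww' i0 j0 ij; have [ne bne] := ok v w vw.
  have hv : h v w <> h v w' by move/(inj v _ _ vw vw').
  case: (S v w i) => [[hi ->]|[hi ->]|[hi ->]|[[hi ->]|[hi ->]]];
  case: (S v w' j) => [[hj ->]|[hj ->]|[hj ->]|[[hj ->]|[hj ->]]] //; try lia;
  move=> e; have /= e1 := congr1 fst e; have /= := congr1 snd e; try rewrite e1; move=> e2;
  clear e S ok inj hC twG; try congruence; turn_lia.
Qed.

End Short.

(** * Filling the edges when [k < d] *)

Section LongEdge.
Variables (d : nat) (x y : letter) (s : letter -> bool).


(* [s c] tells whether the two ends of the edge have the same bit for [c]: a
   color found at distance [p] from one end on its half-edge labelled [c] is at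
   distance [convert c p] on the half-edge labelled [c] at the other end.  The
   letter [None] includes the center, at distance 0. *)
Definition top (c : letter) := if c is Some _ then k.+1 else k.

Definition convert c p := if s c then p else top c - p.

Lemma convert_color c p : color (c, p) -> color (c, convert c p).
Proof. by rewrite /color /convert /top; case: c => [c|] /=; case: ifP; lia. Qed.

Lemma convertK c p : color (c, p) -> convert c (convert c p) = p.
Proof. by rewrite /color /convert /top; case: c => [c|] /=; case: (s _) => /=; lia. Qed.

Hypotheses (kd : k < d) (dk : d <= k.*2).
Hypothesis s_ok : (forall c, s c = false) \/ (x = y /\ s x = false).

(* The color of the [i]-th vertex of an edge whose half-edges are labelled [x]
   and [y] is described by its letter [c] and its distance on the half-edge
   labelled [c] at the first end.  If [x != y], the first [early y] inner
   vertices reuse the letter [y], and the last [early x] ones the letter [x]. *)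
Definition early (c : letter) := (d - k + (c == None))./2.

(** If [x == y], the two other letters share the inner vertices. A letter reused near an end, at
    position [i] from it, gets level [k.*2.+1 - i] there, so that its color recurs across this end
    only at distance [2 k + 1]. *)
Definition inner_slot r : letter * nat :=
  if x == y then
    if r <= uphalf d then (lrot x, k.+1 - r)
    else (lrot (lrot x), convert (lrot (lrot x)) (k + r - d))
  else if r <= early y then (y, k.+1 - r)
  else if r <= d - early x then (third x y, k.+1 + early y - r)
  else (x, convert x (k + r - d)).

Definition slot i : letter * nat :=
  if i <= k then (if i == 0 then None else x, i)
  else if i <= k + d then inner_slot (i - k)
  else let c := if i == k.*2.+1 + d then None else y in
       (c, convert c (k.*2.+1 + d - i)).

Ltac slot_cases :=
  move: s_ok; rewrite /slot /inner_slot /early /convert /top /color;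
  move: (uphalf d) (uphalf_half d) (odd_double_half d) => u hu hd;
  case: x y => [[]|] [[]|] [];
  match goal with
  | |- _ /\ _ -> _ => let H := fresh in intros [? H]; try discriminate; rewrite /= ?H
  | |- _ => let H := fresh in intro H; rewrite /= ?H
  end; rewrite /= ?add1n ?addn0;
  repeat (case: ifP => ?; try (exfalso; lia)).

(** [early c] is the largest number of reused colors that stay more than [2 k] away from the
    half-edge labelled [c] on the same edge; [None] gains a unit because its levels start at 0. The
    levels of the third letter suffice for the rest. *)
Lemma slot_inj i j : i < j -> j <= k.*2.+1 + d -> j <= i + k.*2 -> slot i <> slot j.
Proof.
move=> ij jn jik e.
have := congr1 fst e; have := congr1 snd e; clear e.
have [jn'|jn'] : j < k.*2.+1 + d \/ j = k.*2.+1 + d by lia.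
  by slot_cases; try discriminate; move=> /= e1 e2; try discriminate e2; lia.
by slot_cases; try discriminate; move=> /= e1 e2; try discriminate e2; lia.
Qed.

Lemma slot_color i : i <= k.*2.+1 + d -> color (slot i).
Proof. by move=> i_n; slot_cases => /=; lia. Qed.

Lemma slotn : slot (k.*2.+1 + d) = (None, convert None 0).
Proof.
rewrite /slot ifF; last by lia.
rewrite ifF; last by lia.
by rewrite eqxx subnn.
Qed.

Lemma slot_head i : 0 < i <= k -> slot i = (x, i).
Proof. by case/andP=> i0 ik; rewrite /slot ik ifF //; lia. Qed.

Lemma slot_tail i : 0 < i <= k -> slot (k.*2.+1 + d - i) = (y, convert y i).
Proof.
case/andP=> i0 ik; rewrite /slot ifF; last by lia.
rewrite ifF; last by lia.
rewrite ifF; last by lia.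
by congr (_, convert _ _); lia.
Qed.

(** The letter [x] is absent from the other half-edges at this end, and any other color is more than
    [2 k] away from its copy there. *)
Lemma slot_mid i : k < i <= k.*2 -> (slot i).1 = x \/ k.*2 < (slot i).2 + i.
Proof. by case/andP=> ki ik; slot_cases; [> (try by left); right => /=; lia ..]. Qed.

Lemma slot_mid_tail i : k < i <= k.*2 -> let z := slot (k.*2.+1 + d - i) in
  z.1 = y \/ k.*2 < convert z.1 z.2 + i.
Proof. by case/andP=> ki ik; slot_cases; [> (try by left); right => /=; lia ..]. Qed.

End LongEdge.

End Schemes.

Section Long.
Variables (G : sgraph) (k d : nat) (h : G -> G -> letter) (b : G -> letter -> bool).
Hypotheses (kd : k < d) (dk : d <= k.*2).
Hypothesis inj : forall v, locally_inj h v.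
Hypothesis opposite : forall v w, adj v w ->
  (forall c, b v c <> b w c) \/ (h v w = h w v /\ b v (h v w) <> b w (h v w)).
Implicit Types (v w : G).

Let n := k.*2.+1 + d.

Definition agree v w c := b v c == b w c.

(** From the distance on a half-edge at [v] to the actual color: the bit gives the direction in
    which the levels run. *)
Definition place v (z : letter * nat) := (z.1, if b v z.1 then top k z.1 - z.2 else z.2).

Definition slot_of v w := slot k d (h v w) (h w v) (agree v w).

(** [slot] treats the two ends differently, so each edge is read from its end of smaller rank. *)
Definition long_color v w i :=
  if enum_rank v < enum_rank w then place v (slot_of v w i)
  else place w (slot_of w v (n - i)).

Lemma agree_ok v w : adj v w -> (forall c, agree v w c = false) \/
  (h v w = h w v /\ agree v w (h v w) = false).
Proof.
case/opposite => [o|[e o]]; [left=> c|right; split=> //]; exact/eqP.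
Qed.

Lemma place_color v z : color k z -> color k (place v z).
Proof. by case: z => [[c|] p]; rewrite /color /place /top /=; case: ifP; lia. Qed.

Lemma place_inj v z z' : color k z -> color k z' -> place v z = place v z' -> z = z'.
Proof.
case: z z' => [c p] [c' p']; rewrite /color /place /= => h1 h2 e.
have /= ec := congr1 fst e; have /= := congr1 snd e; rewrite -ec in h2 *.
by case: ifP => _ ep; congr pair; move: h1 h2 ep; rewrite /top; case: (c) => [?|]; lia.
Qed.

Lemma place_convert v w z : color k z ->
  place w z = place v (z.1, convert k (agree w v) z.1 z.2).
Proof.
case: z => [c p]; rewrite /color /place /convert /agree /= => cp; congr pair.
by move: cp; rewrite /top; case: c => [c|]; case: (b w _) (b v _) => [] [] /=; lia.
Qed.

(** The view of the edge from [v], whichever end it is read from; it contains all that is needed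
    around a vertex. *)
Lemma long_colorE v w : adj v w -> exists f : nat -> letter * nat,
  [/\ forall i, i <= n -> long_color v w i = place v (f i) /\ color k (f i),
      f 0 = (None, 0),
      forall i, 0 < i <= k -> f i = (h v w, i) &
      forall i, k < i <= k.*2 -> (f i).1 = h v w \/ k.*2 < (f i).2 + i].
Proof.
move=> vw; have wv : adj w v by rewrite adj_sym.
have ok := agree_ok vw; have ok' := agree_ok wv.
rewrite /long_color; case: (_ < _).
  exists (slot_of v w); split=> // i hi; first by split=> //; exact: slot_color.
  - exact: slot_head.
  - exact: slot_mid.
exists (fun i => let z := slot_of w v (n - i) in (z.1, convert k (agree w v) z.1 z.2)).
have colz i : i <= n -> color k (slot_of w v (n - i)).
  by move=> _; apply: slot_color => //; exact: leq_subr.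
split=> [i hi||i hi|i hi] /=.
- split; first exact/place_convert/colz.
  by apply: convert_color; have := colz i hi; case: slot_of.
- by rewrite subn0 /slot_of /n (slotn kd dk ok') /= convertK.
- rewrite /slot_of slot_tail //= convertK // /color /=; case: (h v w) => //; lia.
- exact: slot_mid_tail.
Qed.

Lemma long_edge_coloring :
  exists F : G -> G -> nat -> nat, @edge_coloring G n (3 * k).+1 k.*2 F.
Proof.
have slot_col v w i : adj v w -> i <= n -> color k (slot_of v w i).
  by move=> vw i_n; apply: slot_color => //; exact: agree_ok.
apply: (@edge_coloring_code G k n k.*2 long_color); last by rewrite /n; lia.
- move=> v w i vw i_n; rewrite /long_color; case: ifP => _; apply: place_color; apply: slot_col => //.
    by rewrite adj_sym.
  exact: leq_subr.
- move=> v w i vw i_n; rewrite /long_color; case: ltngtP => [||/val_inj/enum_rank_inj e].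
  + by rewrite subKn.
  + by [].
  + by rewrite e adj_irrefl in vw.
- move=> v w w' vw vw'.
  have [f [fE f0 _ _]] := long_colorE vw; have [f' [f'E f'0 _ _]] := long_colorE vw'.
  by rewrite (fE 0 (leq0n n)).1 (f'E 0 (leq0n n)).1 f0 f'0.
- move=> v w i j vw ij jn jik; have wv : adj w v by rewrite adj_sym.
  have agr := agree_ok vw; have agr' := agree_ok wv.
  rewrite /long_color; case: ifP => _ /place_inj e.
    by apply: (@slot_inj k d (h v w) (h w v) (agree v w)) (e _ _) => //; apply: slot_col => //; lia.
  have {}e : slot_of w v (n - j) = slot_of w v (n - i) by symmetry; apply: e; apply: slot_col => //; lia.
  by apply: (@slot_inj k d (h w v) (h v w) (agree w v)) e => //; lia.
(* As [i + j <= k.*2], one of the two positions is at most [k]; by symmetry it is [j]. *)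
- have vert v w w' i j : adj v w -> adj v w' -> w <> w' -> 0 < i -> 0 < j <= k ->
      i + j <= k.*2 -> long_color v w i <> long_color v w' j.
    move=> vw vw' ww' i0 jk ij.
    have [f [fE _ fh fm]] := long_colorE vw; have [f' [f'E _ f'h _]] := long_colorE vw'.
    have [|-> ci] := fE i; first by rewrite /n; lia.
    have [|-> cj] := f'E j; first by rewrite /n; lia.
    have hv : h v w <> h v w' by move/(inj vw vw').
    move/(place_inj ci cj); rewrite (f'h j jk).
    case: (leqP i k) => ik; first by rewrite fh ?i0 // => -[].
    case: (fm i) => [|e1 e|h1 e]; first by lia.
      by move: hv; rewrite -e1 e.
    by move: h1; rewrite e /=; lia.
  move=> v w w' i j vw vw' ww' i0 j0 ij.
  case: (leqP j k) => jk; first by apply: vert => //; rewrite j0.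
  by move/esym; apply: vert => //; [move/esym|lia|lia].
Qed.

End Long.

(** * Coloring with [3 k + 1] colors and conclusion *)

Lemma edge_coloring_exists (G : sgraph) k n :
  (forall v : G, #|[set w | adj v w]| <= 3) -> k.*2 < n ->
  exists F : G -> G -> nat -> nat, @edge_coloring G n (3 * k).+1 k.*2 F.
Proof.
move=> deg3 kn.
(* The remainder is [d], and the quotient counts the insertions of [2 k + 1] repeated colors. *)
have -> : n = k.*2.+1 + (n - k.*2.+1) %% k.*2.+1 + (n - k.*2.+1) %/ k.*2.+1 * k.*2.+1.
  by have := divn_eq (n - k.*2.+1) k.*2.+1; lia.
elim: (_ %/ _) => [|q [F colF]]; last first.
  rewrite mulSn [k.*2.+1 + q * _]addnC addnA.
  by apply: edge_coloring_extend colF; lia.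
rewrite mul0n addn0; set d := _ %% _.
have dk : d <= k.*2 by rewrite -ltnS /d ltn_mod.
case: (leqP d k) => kd.
  by have [h [b tw]] := twisted_exists deg3; exact: short_edge_coloring tw.
have [h [b [inj bal]]] := balanced_exists deg3.
exact: long_edge_coloring inj bal.
Qed.

Theorem theorem4p3 (m n : nat) (m_gt0 : 0 < m) (n_gt0 : 0 < n) (lt_mn : m < n)
    (even_m : ~~ odd m) (G : sgraph) (Delta3 : max_degree G = 3) :
  chromatic_number (fractional_power G m n) =
  clique_number (fractional_power G m n).
Proof.
have deg3 (v : G) : #|[set w | adj v w]| <= 3.
  by rewrite -Delta3 (leq_bigmax_cond v).
have em : m = m./2.*2 by rewrite even_halfK.
set k := m./2 in em; rewrite em in lt_mn m_gt0 *.
have [v degv] : exists v : G, #|[set w | adj v w]| = 3.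
  have [|v vmax] := @eq_bigmax G (fun v => #|[set w | adj v w]|).
    rewrite lt0n; apply: contra_eq_neq Delta3 => G0.
    rewrite /max_degree big1 // => v.
    by have := max_card (pred1 v); rewrite card1 G0.
  by exists v; rewrite -vmax -Delta3.
apply/eqP; rewrite eqn_leq clique_number_leq andbT.
have kn : k < n by lia.
(* The ball around a vertex of degree 3 reduces the claim to a coloring with [3 k + 1] colors. *)
apply: leq_trans (ball_clique_number n_gt0 v kn); rewrite degv mulnC.
have [F colF] := edge_coloring_exists deg3 lt_mn.
rewrite /chromatic_number; case: ex_minnP => c _; apply.
exact: edge_coloring_colorable colF.
Qed.
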